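(* Let $S$ be a set of places of $\mathbb{Q}$, let $X$ be the set of places of $\overline{\mathbb{Q}}$ dividing a place in $S$, let $\mathcal J^*$ be the real vector space of consistent maps $c:\mathcal J\to\mathbb{R}$, and let $\mathcal L^*$ be the algebraic dual of $\mathcal L=LC_c(X)$. Then the map $\Phi^*:\mathcal J^*\to\mathcal L^*$, $\Phi^*(c)=\Phi_c$, is a vector space isomorphism of $\mathcal J^*$ onto $\mathcal L^*$.
   Context: Fix an algebraic closure $\overline{\mathbb{Q}}$; number fields lie inside it. For a number field $K$ and place $v$ of $K$, $K_v$ is the completion and $\mathbb{Q}_v$ the completion of $\mathbb{Q}$ at the place below $v$. $Y$ is the set of all places of $\overline{\mathbb{Q}}$ and $Y(K,v)=\{y\in Y:y\mid v\}$; $Y$ has the topology with basis $\{Y(K,v)\}$ ($K$ ranging over number fields, $v$ over places of $K$), and $X\subseteq Y$ the subspace topology. $M_K(S)$ is the set of places of $K$ dividing a place of $S$, and $\mathcal J=\{(K,v): K \text{ a number field},\ v\in M_K(S)\}$. A map $c:\mathcal J\to\mathbb{R}$ is consistent if $c(K,v)=\sum_{w\mid v}c(L,w)$ for all $(K,v)\in\mathcal J$ and all finite extensions $L/K$ (sum over places $w$ of $L$ dividing $v$); these form a real vector space under pointwise operations. $LC_c(X)$ is the real vector space of locally constant, compactly supported functions $X\to\mathbb{R}$. For each $f\in LC_c(X)$ there is a number field $K$ such that $f$ is constant on each $Y(K,v)$, $v\in M_K(S)$, with value (denoted $f(v)$) equal to $0$ for all but finitely many $v$. For consistent $c$, define $\Phi_c(f)=\sum_{v\in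 M_K(S)}c(K,v)f(v)$ for any such $K$; this is independent of the choice of $K$ and $\Phi_c$ is a linear functional on $LC_c(X)$. *)

(* Defs.v *)
From HB Require Import structures.
From mathcomp Require Import all_boot all_order all_algebra all_field.
From mathcomp Require Import all_classical all_reals.
From mathcomp Require Import exp.
Set Implicit Arguments. Unset Strict Implicit. Unset Printing Implicit Defensive.
Import Order.TTheory GRing.Theory Num.Theory.
Local Open Scope classical_set_scope.
Local Open Scope ring_scope.

(* Qbar := algC (the algebraic numbers); number fields are subsets of algC. *)
Definition Qfield : set algC := [set x | x \in Crat].

Definition is_number_field (K : set algC) : Prop :=
  [/\ K 0 /\ K 1,
      (forall x y, K x -> K y -> K (x - y)),
      (forall x y, K x -> K y -> K (x * y)),
      (forall x, K x -> K x^-1) &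
      exists s : seq algC, {subset s <= K} /\
        forall x, K x -> exists c : seq algC,
          [/\ size c = size s, all (mem Crat) c &
              x = \sum_(i < size s) c`_i * s`_i]].

Section Places.
Variable R : realType.

(* an absolute value on the field K (values off K are irrelevant) *)
Definition is_absval (K : set algC) (phi : algC -> R) : Prop :=
  [/\ (forall x, K x -> 0 <= phi x),
      (forall x, K x -> (phi x = 0 <-> x = 0)),
      (forall x y, K x -> K y -> phi (x * y) = phi x * phi y) &
      (forall x y, K x -> K y -> phi (x + y) <= phi x + phi y)].

Definition nontrivial_absval (K : set algC) (phi : algC -> R) : Prop :=
  exists x, [/\ K x, x != 0 & phi x != 1].

Definition absval_equiv (K : set algC) (phi psi : algC -> R) : Prop :=
  exists t : R, 0 < t /\ forall x, K x -> psi x = phi x `^ t.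

Definition is_place (K : set algC) (P : set (algC -> R)) : Prop :=
  exists phi, [/\ is_absval K phi, nontrivial_absval K phi &
    P = [set psi | is_absval K psi /\ absval_equiv K phi psi]].

(* For a place w of L ⊇ K and a place v of K, w | v  iff  w ⊆ v
   (i.e. the absolute values in w restrict to absolute values in v). *)
Definition place_above (w v : set (algC -> R)) : Prop := w `<=` v.

Variable S : set (set (algC -> R)).   (* a set of places of Q *)

Definition MS (K : set algC) : set (set (algC -> R)) :=
  [set v | is_place K v /\ exists2 s, S s & place_above v s].

Definition inJ (K : set algC) (v : set (algC -> R)) : Prop :=
  is_number_field K /\ MS K v.

Definition Yplaces : set (set (algC -> R)) := [set y | is_place setT y].
Definition Ybasic (v : set (algC -> R)) : set (set (algC -> R)) :=
  [set y | Yplaces y /\ place_above y v].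

Definition Xset : set (set (algC -> R)) :=
  [set y | Yplaces y /\ exists2 s, S s & place_above y s].

(* open subsets of X for the subspace topology of the topology on Y
   with basis {Y(K,v)} *)
Definition openX (U : set (set (algC -> R))) : Prop :=
  U `<=` Xset /\
  forall x, U x -> exists K v, [/\ is_number_field K, is_place K v, Ybasic v x &
                                   Ybasic v `&` Xset `<=` U].

Definition closureX (A : set (set (algC -> R))) : set (set (algC -> R)) :=
  [set x | Xset x /\ forall U, openX U -> U x -> U `&` A !=set0].

Definition compactX (C : set (set (algC -> R))) : Prop :=
  C `<=` Xset /\
  forall F : set (set (set (algC -> R))),
    (forall U, F U -> openX U) -> C `<=` \bigcup_(U in F) U ->
    exists s : seq (set (set (algC -> R))),
      (forall U, U \in s -> F U) /\ C `<=` \bigcup_(U in [set U | U \in s]) U.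

(* Functions X -> R are represented by functions Y-type -> R, only their
   values on X matter. *)
Definition locally_constantX (f : set (algC -> R) -> R) : Prop :=
  forall x, Xset x -> exists U, [/\ openX U, U x & forall y, U y -> f y = f x].

Definition supportX (f : set (algC -> R) -> R) : set (set (algC -> R)) :=
  [set x | Xset x /\ f x != 0].

Definition LCc (f : set (algC -> R) -> R) : Prop :=
  locally_constantX f /\ compactX (closureX (supportX f)).

(* consistent maps c : J -> R (represented as total functions; only the
   values on J matter) *)
Definition consistent (c : set algC -> set (algC -> R) -> R) : Prop :=
  forall K v L, inJ K v -> is_number_field L -> K `<=` L ->
    c K v = \sum_(w \in [set w | is_place L w /\ place_above w v]) c L w.

Definition adapted (K : set algC) (f : set (algC -> R) -> R) : Prop :=
  [/\ is_number_field K,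
      (forall v, MS K v -> forall y z, Ybasic v y -> Ybasic v z -> f y = f z) &
      finite_set [set v | MS K v /\ exists2 y, Ybasic v y & f y != 0]].

Definition fval (f : set (algC -> R) -> R) (v : set (algC -> R)) : R :=
  xget 0 [set r | exists2 y, Ybasic v y & r = f y].

Definition Phi_at (c : set algC -> set (algC -> R) -> R) (K : set algC)
  (f : set (algC -> R) -> R) : R :=
  \sum_(v \in MS K) c K v * fval f v.

(* Phi_c(f) := Phi_at c K f for any adapted K (independent of K) *)
Definition Phi (c : set algC -> set (algC -> R) -> R)
  (f : set (algC -> R) -> R) : R :=
  xget 0 [set r | exists2 K, adapted K f & r = Phi_at c K f].

(* elements of the algebraic dual of LC_c(X): linear functionals on LC_c(X),
   well defined on functions X -> R *)
Definition dual_functional (lam : (set (algC -> R) -> R) -> R) : Prop :=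
  (forall f g, LCc f -> LCc g -> (forall x, Xset x -> f x = g x) -> lam f = lam g) /\
  (forall f g (a b : R), LCc f -> LCc g ->
     lam (fun x => a * f x + b * g x) = a * lam f + b * lam g).

End Places.

(* Main.v *)
Require Import Defs.
From HB Require Import structures.
From mathcomp Require Import all_boot all_order all_algebra all_field.
From mathcomp Require Import all_classical all_reals.
From mathcomp Require Import exp.
From mathcomp Require Import ring lra zify.
Set Implicit Arguments. Unset Strict Implicit. Unset Printing Implicit Defensive.
Import Order.TTheory GRing.Theory Num.Theory.
Local Open Scope classical_set_scope.
Local Open Scope ring_scope.

(* The sets Y(K,v), v in M_K(S), partition X, and passing from K to a finite
   extension L refines this partition into finitely many pieces. Granting that
   each Y(K,v) is nonempty and compact, the functions in LC_c(X) are exactly the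
   finite linear combinations of the indicators of the Y(K,v) for a single K, and
   a consistent map c is the same thing as a functional, via
   c(K,v) = lambda(1_{Y(K,v)}).

   Nonemptiness is the extension of absolute values to Qbar. It is proved
   uniformly in the archimedean and non-archimedean cases: among the
   submultiplicative seminorms on rings between K and Qbar that are bounded by the
   given absolute value on K, a finest one exists by Zorn's lemma and is
   multiplicative.

   Finiteness of the set of w | v is a pigeonhole argument: an element z of L is
   found on which all the (normalized) absolute values differ, and the rational
   relation of bounded length satisfied by the powers of z^N, N large, forces
   two terms of that relation to have comparable size at each w.

   Compactness of Y(K,v) follows from finiteness by Koenig's lemma along a tower
   of number fields exhausting Qbar. *)

(** * Subrings of the algebraic numbers *)

Definition subring (D : set algC) : Prop :=
  [/\ D 1, (forall x y, D x -> D y -> D (x - y)) &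
      (forall x y, D x -> D y -> D (x * y))].

Section Subring.
Variables (D : set algC) (rD : subring D).

Lemma subring1 : D 1. Proof. by case: rD. Qed.
Lemma subringB x y : D x -> D y -> D (x - y). Proof. by case: rD => _ h _; exact: h. Qed.
Lemma subringM x y : D x -> D y -> D (x * y). Proof. by case: rD => _ _; apply. Qed.
Lemma subring0 : D 0. Proof. by rewrite -(subrr 1); apply: subringB; exact: subring1. Qed.
Lemma subringN x : D x -> D (- x).
Proof. by move=> Dx; rewrite -sub0r; apply: subringB => //; exact: subring0. Qed.
Lemma subringD x y : D x -> D y -> D (x + y).
Proof. by move=> Dx Dy; rewrite -[y]opprK; apply: subringB => //; exact: subringN. Qed.
Lemma subringX x n : D x -> D (x ^+ n).
Proof.
by move=> Dx; elim: n => [|n IH]; rewrite ?expr0 ?exprS; [exact: subring1|exact: subringM].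
Qed.
Lemma subring_nat n : D n%:R.
Proof.
elim: n => [|n IH]; first exact: subring0.
by rewrite -natr1; apply: subringD => //; exact: subring1.
Qed.
Lemma subring_sum I (r : seq I) (P : pred I) (F : I -> algC) :
  (forall i, P i -> D (F i)) -> D (\sum_(i <- r | P i) F i).
Proof. by move=> h; apply: big_ind => //; [exact: subring0|exact: subringD]. Qed.

Definition poly_on (p : {poly algC}) : Prop := forall i, D p`_i.

Lemma poly_onC c : D c -> poly_on c%:P.
Proof. by move=> Dc i; rewrite coefC; case: ifP => _ //; exact: subring0. Qed.
Lemma poly_onXn n : poly_on 'X^n.
Proof. by move=> i; rewrite coefXn; exact: subring_nat. Qed.
Lemma poly_onD p q : poly_on p -> poly_on q -> poly_on (p + q).
Proof. by move=> hp hq i; rewrite coefD; apply: subringD. Qed.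
Lemma poly_onB p q : poly_on p -> poly_on q -> poly_on (p - q).
Proof. by move=> hp hq i; rewrite coefB; apply: subringB. Qed.
Lemma poly_onM p q : poly_on p -> poly_on q -> poly_on (p * q).
Proof. by move=> hp hq i; rewrite coefM; apply: subring_sum => j _; apply: subringM. Qed.
Lemma poly_onZ c p : D c -> poly_on p -> poly_on (c *: p).
Proof. by move=> Dc hp i; rewrite coefZ; apply: subringM. Qed.

Definition adjoin (a : algC) : set algC :=
  [set x | exists p, poly_on p /\ x = p.[a]].

Lemma adjoin_id a x : D x -> adjoin a x.
Proof. by move=> Dx; exists x%:P; split; [exact: poly_onC|rewrite hornerC]. Qed.

Lemma adjoin_gen a : adjoin a a.
Proof. by exists 'X^1; split; [exact: poly_onXn|rewrite hornerXn expr1]. Qed.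

Lemma adjoin_subring a : subring (adjoin a).
Proof.
split; first by apply: adjoin_id; exact: subring1.
- move=> _ _ [p [hp ->]] [q [hq ->]]; exists (p - q).
  by split; [exact: poly_onB|rewrite !hornerE].
- move=> _ _ [p [hp ->]] [q [hq ->]]; exists (p * q).
  by split; [exact: poly_onM|rewrite !hornerE].
Qed.

End Subring.

Lemma Qfield_ratr q : Qfield (ratr q).
Proof. by rewrite /Qfield /=; exact: Crat_rat. Qed.

(** Divide powers of X out of a rational polynomial killing [x] until it has the form pX + c with c
    nonzero; then the inverse of [x] is -p(x)/c. So rings between Q and Qbar are fields. *)
Lemma subringV (D : set algC) x : subring D -> Qfield `<=` D -> D x -> D x^-1.
Proof.
move=> rD QD Dx; have [->|x0] := eqVneq x 0; first by rewrite invr0; exact: subring0.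
have DQ (q : rat) : D (ratr q) by apply: QD; exact: Qfield_ratr.
suff h (p : {poly rat}) : p != 0 -> (map_poly ratr p).[x] = 0 -> D x^-1.
  have [p [mp monp] _] := minCpolyP x.
  by apply: (h p); [exact: monic_neq0|apply/eqP; rewrite -mp; exact: root_minCpoly].
elim/poly_ind: p => [|p c IH]; first by rewrite eqxx.
rewrite rmorphD rmorphM /= map_polyX map_polyC !hornerE => pc0 /eqP.
have [c0|c0] := eqVneq c 0.
  rewrite c0 raddf0 addr0 mulf_eq0 (negbTE x0) orbF => /eqP px.
  by apply: IH px; apply: contra_neq pc0 => ->; rewrite c0 mul0r addr0.
rewrite addr_eq0 => /eqP e.
have rc0 : ratr c != 0 :> algC by rewrite fmorph_eq0.
have -> : x^-1 = - (map_poly ratr p).[x] * ratr c^-1.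
  rewrite fmorphV; apply: (mulIf x0); rewrite mulVf //.
  by rewrite mulrAC mulNr e opprK divff.
apply: subringM => //; apply: subringN => //.
rewrite horner_coef; apply: subring_sum => // i _; rewrite coef_map /=.
by apply: subringM => //; exact: (subringX rD).
Qed.

(** * Absolute values *)

Section RealPowers.
Variable R : realType.
Implicit Types a b : R.

Lemma bernoulli a n : 0 <= a -> 1 + n%:R * a <= (1 + a) ^+ n.
Proof.
move=> a0; elim: n => [|n IH]; first by rewrite mul0r addr0 expr0.
rewrite exprS -natr1.
have h : (1 + a) * (1 + n%:R * a) <= (1 + a) * (1 + a) ^+ n.
  by apply: ler_wpM2l => //; rewrite addr_ge0.
apply: le_trans h; have n0 : 0 <= n%:R :> R by [].
by have := mulr_ge0 n0 (mulr_ge0 a0 a0); lra.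
Qed.

Lemma expr_unbounded a b : 1 < a -> exists k, forall n, (k <= n)%N -> b < a ^+ n.
Proof.
move=> a1; pose d := a - 1; have d0 : 0 < d by rewrite subr_gt0.
have ad : a = 1 + d by rewrite /d addrC subrK.
exists (Num.bound (`|b| / d)) => n kn.
have hb : `|b| / d < n%:R.
  apply: (lt_le_trans (archi_boundP _)); first by rewrite divr_ge0 // ltW.
  by rewrite ler_nat.
move: hb; rewrite ltr_pdivrMr // => hb.
apply: (le_lt_trans (ler_norm _)); apply: (lt_trans hb).
by rewrite ad; have := @bernoulli d n (ltW d0); lra.
Qed.

(** If [b < a], the powers of [a / b] outgrow the linear factor [n.+1]. *)
Lemma le_of_expr_le a b : 0 <= a -> 0 <= b ->
  (forall n, a ^+ n <= n.+1%:R * b ^+ n) -> a <= b.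
Proof.
move=> a0 b0 h; rewrite leNgt; apply/negP => ba.
have bp : 0 < b.
  rewrite lt_neqAle b0 andbT; apply/eqP => b0'.
  by have := h 1%N; rewrite !expr1 -b0' mulr0 leNgt b0' ba.
(* With [s = 1 + d], Bernoulli applied to [s ^+ n] and then squared gives the quadratic lower bound
   [(1 + n%:R * d) ^+ 2] for the power of [a / b]; it exceeds [n.+1] as soon as [n%:R * d ^+ 2]
   exceeds 1. *)
pose s := Num.sqrt (a / b).
have ab1 : 1 < a / b by rewrite ltr_pdivlMr // mul1r.
have s2 : s ^+ 2 = a / b by rewrite sqr_sqrtr // divr_ge0.
have s1 : 1 < s by rewrite -sqrtr1 ltr_sqrt // (lt_trans _ ab1).
pose d := s - 1; have d0 : 0 < d by rewrite subr_gt0.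
have sd : s = 1 + d by rewrite /d addrC subrK.
pose n := (Num.bound (d ^+ 2)^-1).
have d20 : 0 < d ^+ 2 by exact: exprn_gt0.
have hn : 1 < n%:R * d ^+ 2.
  rewrite -ltr_pdivrMr // mul1r; apply: archi_boundP.
  by rewrite invr_ge0 ltW.
have n0 : 0 < n%:R :> R by nra.
have b1 := @bernoulli d n (ltW d0); rewrite -sd in b1.
have : (s ^+ n) ^+ 2 <= n.+1%:R.
  rewrite -exprM mulnC exprM s2 expr_div_n ler_pdivrMr ?exprn_gt0 //.
rewrite -natr1.
have h2 : (1 + n%:R * d) ^+ 2 <= (s ^+ n) ^+ 2.
  by rewrite ler_pXn2r // nnegrE ?exprn_ge0 // ?addr_ge0 ?mulr_ge0 // ltW // (lt_trans _ s1).
move=> /(le_trans h2).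
have h3 : n%:R * 1 <= n%:R * (n%:R * d ^+ 2) by apply: ler_wpM2l; exact: ltW.
have h4 : 0 < n%:R * d by exact: mulr_gt0.
by rewrite sqrrD expr1n exprMn expr2; rewrite expr2 in h3; lra.
Qed.

(** Equality holds for at most one exponent: dividing two equalities would make a positive power of
    [a] equal to that power of [a']. *)
Lemma eventually_expr_neq a a' b b' : 0 < a -> 0 < a' -> 0 < b -> 0 < b' -> a != a' ->
  exists k, forall n, (k <= n)%N -> a ^+ n * b != a' ^+ n * b'.
Proof.
move=> a0 a'0 b0 b'0 aa'.
have [[k bad]|good] := pselect (exists k, a ^+ k * b = a' ^+ k * b'); last first.
  by exists 0%N => n _; apply/eqP => e; apply: good; exists n.
exists k.+1 => n kn; apply/eqP => e.
have ek : n = (n - k + k)%N by rewrite subnK // ltnW.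
move: e; rewrite {1 2}ek !exprD -!mulrA bad => e.
have c0 : a' ^+ k * b' != 0 by rewrite gt_eqF // mulr_gt0 // exprn_gt0.
move: (mulIf c0 e) => /eqP; rewrite eqrXn2 ?subn_gt0 ?ltW //.
exact/negP.
Qed.

Lemma powRK a t : 0 < t -> 0 <= a -> (a `^ t) `^ t^-1 = a.
Proof. by move=> t0 a0; rewrite -powRrM mulfV ?gt_eqF // powRr1. Qed.

Lemma powRVK a t : 0 < t -> 0 <= a -> (a `^ t^-1) `^ t = a.
Proof. by move=> t0 a0; rewrite -powRrM mulVf ?gt_eqF // powRr1. Qed.

Lemma powRX a t n : 0 <= a -> (a ^+ n) `^ t = (a `^ t) ^+ n.
Proof.
move=> a0; elim: n => [|n IH]; first by rewrite !expr0 powR1.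
by rewrite !exprS powRM ?exprn_ge0 // IH.
Qed.

End RealPowers.

Section AbsVal.
Variables (R : realType) (K : set algC) (phi : algC -> R).
Hypotheses (rK : subring K) (av : is_absval K phi).

Lemma absval_ge0 x : K x -> 0 <= phi x. Proof. by case: av => h _ _ _; exact: h. Qed.
Lemma absval_eq0 x : K x -> phi x = 0 <-> x = 0. Proof. by case: av => _ h _ _; exact: h. Qed.
Lemma absvalM x y : K x -> K y -> phi (x * y) = phi x * phi y.
Proof. by case: av => _ _ h _; exact: h. Qed.
Lemma absvalD x y : K x -> K y -> phi (x + y) <= phi x + phi y.
Proof. by case: av => _ _ _; exact. Qed.
Lemma absval0 : phi 0 = 0.
Proof. by apply/(absval_eq0 (subring0 rK)). Qed.
Lemma absval_gt0 x : K x -> x != 0 -> 0 < phi x.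
Proof.
move=> Kx x0; rewrite lt_neqAle absval_ge0 // andbT eq_sym; apply/eqP.
by move/(absval_eq0 Kx)/eqP; exact/negP.
Qed.
Lemma absval1 : phi 1 = 1.
Proof.
have K1 := subring1 rK.
have p0 : phi 1 != 0 by rewrite gt_eqF // absval_gt0 ?oner_neq0.
by apply: (mulfI p0); rewrite -absvalM // !mulr1.
Qed.
Lemma absvalN1 : phi (-1) = 1.
Proof.
have KN1 : K (-1) by apply: subringN => //; exact: subring1.
apply/eqP; rewrite -(@eqrXn2 _ 2) //; last exact: absval_ge0.
by rewrite expr2 -absvalM // mulrNN mulr1 absval1 expr1n.
Qed.
Lemma absvalN x : K x -> phi (- x) = phi x.
Proof.
move=> Kx; rewrite -mulN1r absvalM // ?absvalN1 ?mul1r //.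
by apply: subringN => //; exact: subring1.
Qed.
Lemma absvalX x n : K x -> phi (x ^+ n) = phi x ^+ n.
Proof.
move=> Kx; elim: n => [|n IH]; first by rewrite !expr0 absval1.
by rewrite !exprS absvalM // ?IH //; exact: subringX.
Qed.
Lemma absval_nat n : phi n%:R <= n%:R.
Proof.
elim: n => [|n IH]; first by rewrite absval0.
rewrite -!natr1; apply: (le_trans (absvalD (subring_nat rK n) (subring1 rK))).
by rewrite absval1 lerD2r.
Qed.
Lemma absval_sum I (s : seq I) (P : pred I) (F : I -> algC) : (forall i, K (F i)) ->
  phi (\sum_(i <- s | P i) F i) <= \sum_(i <- s | P i) phi (F i).
Proof.
move=> h; elim: s => [|i s IH]; first by rewrite !big_nil absval0.
rewrite !big_cons; case: (P i) => //.
apply: (le_trans (absvalD _ _)) => //; last by rewrite lerD2l.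
by apply: subring_sum.
Qed.

(* Artin's argument: expand (x + y)^n and let n go to infinity. *)
Lemma absval_powR t : 0 < t -> (forall n : nat, phi n%:R `^ t <= n%:R) ->
  is_absval K (fun x => phi x `^ t).
Proof.
move=> t0 tn; split.
- by move=> x _; exact: powR_ge0.
- move=> x Kx; split=> [/powR_eq0_eq0/absval_eq0|->]; first exact.
  by rewrite absval0 powR0 // gt_eqF.
- by move=> x y Kx Ky; rewrite absvalM // powRM // absval_ge0.
move=> x y Kx Ky; set B := (X in _ <= X).
have Kxy := subringD rK Kx Ky.
have B0 : 0 <= B by rewrite addr_ge0 ?powR_ge0.
suff h : phi (x + y) <= B `^ t^-1.
  rewrite -[leRHS](powRVK t0 B0).
  by apply: ge0_ler_powR; rewrite ?nnegrE ?absval_ge0 ?powR_ge0 // ltW.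
apply: le_of_expr_le; rewrite ?absval_ge0 ?powR_ge0 // => n.
rewrite -absvalX // exprDn.
have Kt i : K (x ^+ (n - i) * y ^+ i *+ 'C(n, i)).
  rewrite -mulr_natr; apply: subringM => //; last exact: subring_nat.
  by apply: subringM => //; exact: (subringX rK).
apply: (le_trans (absval_sum _ _ (fun i : 'I_n.+1 => Kt i))).
apply: (@le_trans _ _ (\sum_(i < n.+1) (B `^ t^-1) ^+ n)); last first.
  by rewrite sumr_const card_ord mulr_natl.
apply: ler_sum => i _.
rewrite -[leLHS](powRK t0) ?absval_ge0 // -powRX //.
apply: ge0_ler_powR; rewrite ?nnegrE ?powR_ge0 ?exprn_ge0 ?invr_ge0 ?(ltW t0) //.
have Kxi := subringX rK (n - i) Kx; have Kyi := subringX rK i Ky.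
have Ki := subring_nat rK 'C(n, i).
rewrite -mulr_natr !absvalM ?absvalX //; last exact: subringM.
rewrite !powRM ?mulr_ge0 ?exprn_ge0 ?absval_ge0 // !powRX ?absval_ge0 //.
(* The hypothesis on naturals absorbs the binomial coefficient; what remains is one term of the
   expansion of [B ^+ n]. *)
apply: (@le_trans _ _ ((phi x `^ t) ^+ (n - i) * (phi y `^ t) ^+ i * 'C(n, i)%:R)).
  by apply: ler_wpM2l => //; rewrite mulr_ge0 ?exprn_ge0 ?powR_ge0.
rewrite /B exprDn (bigD1 i) //= mulr_natr lerDl; apply: sumr_ge0 => j _.
by rewrite -mulr_natr !mulr_ge0 ?exprn_ge0 ?powR_ge0.
Qed.

End AbsVal.

Lemma absval_sub (R : realType) (K L : set algC) (phi : algC -> R) :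
  K `<=` L -> is_absval L phi -> is_absval K phi.
Proof.
move=> KL [h1 h2 h3 h4]; split.
- by move=> x /KL; exact: h1.
- by move=> x /KL; exact: h2.
- by move=> x y /KL Lx /KL; exact: h3.
- by move=> x y /KL Lx /KL; exact: h4.
Qed.

(** * Extension of absolute values *)

Section Seminorm.
Variable R : realType.

Lemma le_inf_add (A B : set R) z : A !=set0 -> B !=set0 ->
  (forall a b, A a -> B b -> z <= a + b) -> z <= inf A + inf B.
Proof.
move=> A0 B0 h; rewrite -lerBlDr; apply: lb_le_inf => // a Aa.
rewrite lerBlDr -lerBlDl; apply: lb_le_inf => // b Bb.
by rewrite lerBlDl; exact: h.
Qed.

Lemma le_inf_mul (A B : set R) z : A !=set0 -> B !=set0 ->
  lbound A 0 -> lbound B 0 ->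
  (forall a b, A a -> B b -> z <= a * b) -> z <= inf A * inf B.
Proof.
move=> A0 B0 Age0 Bge0 h.
have step a : A a -> z <= a * inf B.
  move=> Aa; have := Age0 _ Aa; rewrite le_eqVlt => /predU1P[a0|ap].
    by case: B0 => b Bb; have := h _ _ Aa Bb; rewrite -a0 !mul0r.
  rewrite -ler_pdivrMl //; apply: lb_le_inf => // b Bb.
  by rewrite ler_pdivrMl //; exact: h.
have : 0 <= inf B by exact: lb_le_inf.
rewrite le_eqVlt => /predU1P[b0|bp].
  by case: A0 => a Aa; have := step _ Aa; rewrite -b0 !mulr0.
rewrite -ler_pdivrMr //; apply: lb_le_inf => // a Aa.
by rewrite ler_pdivrMr //; exact: step.
Qed.

(** Submultiplicativity, unlike multiplicativity, passes to quotient norms and to infima along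
    chains. *)
Definition is_seminorm (D : set algC) (N : algC -> R) : Prop :=
  [/\ subring D, N 0 = 0, (forall x, D x -> 0 <= N x),
      (forall x y, D x -> D y -> N (x + y) <= N x + N y) &
      (forall x y, D x -> D y -> N (x * y) <= N x * N y)].

(** * Weighted norms on D[X] and their quotients on D[a] *)

Section Weighted.
Variables (D : set algC) (N : algC -> R) (r : R).
Hypotheses (sN : is_seminorm D N) (r0 : 0 < r).

Let rD : subring D. Proof. by case: sN. Qed.
Let N0 : N 0 = 0. Proof. by case: sN. Qed.
Let Nge0 x : D x -> 0 <= N x. Proof. by case: sN => _ _ h _ _; exact: h. Qed.
Let NM x y : D x -> D y -> N (x * y) <= N x * N y.
Proof. by case: sN => _ _ _ _; exact. Qed.
Let NDle x y : D x -> D y -> N (x + y) <= N x + N y.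
Proof. by case: sN => _ _ _ h _; exact: h. Qed.

Lemma seminorm_sum I (s : seq I) (F : I -> algC) : (forall i, D (F i)) ->
  N (\sum_(i <- s) F i) <= \sum_(i <- s) N (F i).
Proof.
move=> h; elim: s => [|i s IH]; first by rewrite !big_nil N0.
rewrite !big_cons; apply: (le_trans (NDle _ _)) => //; last by rewrite lerD2l.
by apply: subring_sum.
Qed.

(** The weighted l1 norm on D[X] in which multiplication by X scales by [r]. *)
Definition wnorm (p : {poly algC}) : R := \sum_(i < size p) N p`_i * r ^+ i.

Lemma wnormE n (p : {poly algC}) : (size p <= n)%N -> wnorm p = \sum_(i < n) N p`_i * r ^+ i.
Proof.
move=> sn; rewrite /wnorm (big_ord_widen _ (fun i => N p`_i * r ^+ i) sn) big_mkcond /=.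
apply: eq_bigr => i _; case: ltnP => // h.
by rewrite nth_default // N0 mul0r.
Qed.

Lemma wnorm_ge0 p : poly_on D p -> 0 <= wnorm p.
Proof.
move=> hp; apply: sumr_ge0 => i _; apply: mulr_ge0; first exact: Nge0.
by apply: exprn_ge0; exact: ltW.
Qed.

Lemma wnormC c : wnorm c%:P = N c.
Proof. by rewrite (@wnormE 1) ?size_polyC_leq1 // big_ord1 coefC /= expr0 mulr1. Qed.

Lemma wnormD p q : poly_on D p -> poly_on D q -> wnorm (p + q) <= wnorm p + wnorm q.
Proof.
move=> hp hq; pose n := maxn (size p) (size q).
rewrite (@wnormE n) ?size_polyD // (@wnormE n p) ?leq_maxl // (@wnormE n q) ?leq_maxr //.
rewrite -big_split /=; apply: ler_sum => i _; rewrite -mulrDl coefD.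
by apply: ler_wpM2r; [apply: exprn_ge0; exact: ltW|exact: NDle].
Qed.

Lemma wnormCM c q : D c -> poly_on D q -> wnorm (c%:P * q) <= N c * wnorm q.
Proof.
move=> Dc hq; rewrite (@wnormE (size q)); last first.
  by rewrite mul_polyC; exact: size_scale_leq.
rewrite /wnorm mulr_sumr; apply: ler_sum => i _; rewrite mulrA coefCM.
by apply: ler_wpM2r; [apply: exprn_ge0; exact: ltW|exact: NM].
Qed.

Lemma wnormMXD p c : wnorm (p * 'X + c%:P) = wnorm p * r + N c.
Proof.
rewrite (@wnormE (size p).+1); last first.
  rewrite (leq_trans (size_polyD _ _)) // geq_max (leq_trans (size_polyC_leq1 _)) // andbT.
  by have [->|p0] := eqVneq p 0; rewrite ?mul0r ?size_poly0 // size_mulX.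
rewrite big_ord_recl /= coefD coefMX coefC /= add0r expr0 mulr1 addrC; congr (_ + _).
rewrite /wnorm mulr_suml; apply: eq_bigr => i _.
by rewrite coefD coefMX coefC /= addr0 exprSr mulrA.
Qed.

Lemma wnormMX p : wnorm (p * 'X) = wnorm p * r.
Proof. by have := wnormMXD p 0; rewrite addr0 N0 addr0. Qed.

Lemma wnormXn p n : wnorm (p * 'X^n) = wnorm p * r ^+ n.
Proof.
by elim: n => [|n IH]; rewrite ?expr0 ?mulr1 // !exprSr !mulrA wnormMX IH.
Qed.

Lemma wnormM p q : poly_on D p -> poly_on D q -> wnorm (p * q) <= wnorm p * wnorm q.
Proof.
elim/poly_ind: p => [|p c IH] hp hq.
  by rewrite mul0r /wnorm size_poly0 !big_ord0 mul0r.
have Dc : D c by have := hp 0%N; rewrite coefD coefMX coefC /= add0r.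
have Dp : poly_on D p by move=> i; have := hp i.+1; rewrite coefD coefMX coefC /= addr0.
rewrite mulrDl mulrAC wnormMXD.
apply: (le_trans (wnormD _ _)).
- by rewrite -['X]expr1; apply: poly_onM => //; [exact: poly_onM|exact: poly_onXn].
- by apply: poly_onM => //; exact: poly_onC.
rewrite wnormMX mulrDl; apply: lerD; last exact: wnormCM.
by rewrite mulrAC; apply: ler_wpM2r; [exact: ltW|exact: IH].
Qed.

Variable a : algC.

(** The quotient seminorm of [wnorm] under evaluation D[X] -> D[a]. *)
Definition qnorm (x : algC) : R :=
  inf [set s | exists p, [/\ poly_on D p, p.[a] = x & s = wnorm p]].

Lemma qnorm_le p : poly_on D p -> qnorm p.[a] <= wnorm p.
Proof.
move=> hp; apply: ge_inf; last by exists p.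
by exists 0 => _ [q [hq _ ->]]; exact: wnorm_ge0.
Qed.

Lemma qnorm_ge x c : adjoin D a x ->
  (forall p, poly_on D p -> p.[a] = x -> c <= wnorm p) -> c <= qnorm x.
Proof.
move=> [p [hp ->]] h; apply: lb_le_inf; first by exists (wnorm p), p.
by move=> _ [q [hq e ->]]; exact: h.
Qed.

Lemma qnorm_seminorm : is_seminorm (adjoin D a) qnorm.
Proof.
split; first exact: adjoin_subring.
- apply/eqP; rewrite eq_le; apply/andP; split.
    have := @qnorm_le 0%:P (poly_onC rD (subring0 rD)).
    by rewrite wnormC N0 horner0.
  apply: qnorm_ge => [|p hp _]; last exact: wnorm_ge0.
  by apply: adjoin_id => //; exact: subring0.
- by move=> x hx; apply: qnorm_ge => // p hp _; exact: wnorm_ge0.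
- move=> _ _ [p0 [hp0 ->]] [q0 [hq0 ->]]; apply: le_inf_add.
  + by exists (wnorm p0), p0.
  + by exists (wnorm q0), q0.
  + move=> _ _ [p [hp <- ->]] [q [hq <- ->]]; rewrite -hornerD.
    by apply: le_trans (wnormD hp hq); apply: qnorm_le; exact: poly_onD.
- move=> _ _ [p0 [hp0 ->]] [q0 [hq0 ->]]; apply: le_inf_mul.
  + by exists (wnorm p0), p0.
  + by exists (wnorm q0), q0.
  + by move=> _ [p [hp _ ->]]; exact: wnorm_ge0.
  + by move=> _ [p [hp _ ->]]; exact: wnorm_ge0.
  + move=> _ _ [p [hp <- ->]] [q [hq <- ->]]; rewrite -hornerM.
    by apply: le_trans (wnormM hp hq); apply: qnorm_le; exact: poly_onM.
Qed.

End Weighted.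
End Seminorm.

(* Reduction modulo the minimal polynomial of a does not increase the weighted
   norm once r is large enough. *)
Lemma wnorm_lower_bound (R : realType) (D : set algC) (N : algC -> R) :
  is_seminorm D N -> Qfield `<=` D -> forall a, exists2 r, 0 < r &
  forall p, poly_on D p -> p.[a] = 1 -> N 1 <= wnorm N r p.
Proof.
move=> sN QD a; have [rD N0 Nge0 ND NM] := sN.
(* The least degree of a monic polynomial over [D] itself, not over Q, that vanishes at [a]. *)
pose P n := `[< exists m, [/\ poly_on D m, m \is monic, m.[a] = 0 & size m = n.+1] >].
have exP : exists n, P n.
  exists (size (minCpoly a)).-1; apply/asboolP; exists (minCpoly a); split.
  - have [q [-> _] _] := minCpolyP a; move=> i; rewrite coef_map; apply: QD.
    exact: Qfield_ratr.
  - exact: minCpoly_monic.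
  - exact/eqP/root_minCpoly.
  - by rewrite prednK // (leq_trans _ (size_minCpoly a)).
case: (ex_minnP exP) => d /asboolP[m [hm mm ma sm]] mind.
have md : m`_d = 1 by move/monicP: mm; rewrite lead_coefE sm.
pose m0 := 'X^d - m.
have hm0 : poly_on D m0 by apply: poly_onB => //; exact: poly_onXn.
have m0d i : (d <= i)%N -> m0`_i = 0.
  rewrite leq_eqVlt coefB coefXn => /predU1P[<-|di]; first by rewrite eqxx md subrr.
  by rewrite gtn_eqF // nth_default ?sm // subr0.
have sm0 : (size m0 <= d)%N by apply/leq_sizeP.
(* Since [r] is at least 1 and at least the sum of the coefficient norms, [m0], whose value at [a]
   is [a ^+ d], has weighted norm at most [r ^+ d]. *)
pose r := 1 + \sum_(i < d) N m0`_i.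
have r1 : 1 <= r by rewrite lerDl; apply: sumr_ge0 => i _; exact: Nge0.
have r0 : 0 < r by exact: lt_le_trans r1.
exists r => //.
have d0 : (0 < d)%N.
  rewrite lt0n; apply/eqP => d0; move: ma; have /size_poly1P[c c0 mE] : size m == 1%N.
    by rewrite sm d0.
  by rewrite mE hornerC => /eqP; rewrite (negbTE c0).
have wm0 : wnorm N r m0 <= r ^+ d.
  rewrite (wnormE r sN sm0); case: d d0 {md mind sm m0d} @m0 hm0 sm0 @r r1 r0 => // d _.
  move=> m0 hm0 sm0 r r1 r0.
  apply: (@le_trans _ _ ((\sum_(i < d.+1) N m0`_i) * r ^+ d)).
    rewrite mulr_suml; apply: ler_sum => i _; apply: ler_wpM2l; first exact: Nge0.
    by rewrite ler_weXn2l // -ltnS.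
  rewrite exprS; apply: ler_wpM2r; first by apply: exprn_ge0; exact: ltW.
  by rewrite /r lerDr.
suff main n : forall p : {poly algC}, (size p <= n)%N -> poly_on D p -> p.[a] = 1 ->
    N 1 <= wnorm N r p by move=> p; exact: main.
elim: n => [|n IH] p sp hp pa.
  move: sp pa; rewrite leqn0 size_poly_eq0 => /eqP->.
  by rewrite horner0 => /eqP; rewrite eq_sym oner_eq0.
have [spd|dsp] := leqP (size p) d.
  (* Otherwise p - 1, made monic, would vanish at [a] in degree below [d]. *)
  have -> : p = 1%:P; last by rewrite (wnormC r sN).
  apply/eqP; rewrite -subr_eq0; apply/negPn/negP => p1.
  set q := p - 1%:P in p1.
  have hq : poly_on D q by apply: poly_onB => //; apply: poly_onC => //; exact: subring1.
  have sq : (size q <= d)%N.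
    rewrite (leq_trans (size_polyD _ _)) // geq_max spd size_polyN.
    by rewrite (leq_trans (size_polyC_leq1 _)).
  have l0 : (lead_coef q)^-1 != 0 by rewrite invr_eq0 lead_coef_eq0.
  have sq1 : (size q).-1.+1 = size q by rewrite prednK // size_poly_gt0.
  suff /mind : P (size q).-1 by rewrite leqNgt sq1 sq.
  apply/asboolP; exists ((lead_coef q)^-1 *: q); split.
  - by apply: poly_onZ => //; apply: subringV => //; exact: hq.
  - by rewrite monicE lead_coefZ mulVf // lead_coef_eq0.
  - by rewrite hornerZ hornerD hornerN pa hornerC subrr mulr0.
  - by rewrite size_scale.
have [k sk] : exists k, size p = k.+1 by case: (size p) dsp => // k _; exists k.
have dk : (d <= k)%N by move: dsp; rewrite sk.
pose c := p`_k; have Dc : D c by exact: hp.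
pose p0 := p - c%:P * 'X^k.
have hp0 : poly_on D p0.
  by apply: poly_onB => //; apply: poly_onM => //; [exact: poly_onC|exact: poly_onXn].
have cp0 i : p0`_i = if (i < k)%N then p`_i else 0.
  rewrite coefB coefCM coefXn; case: ltngtP => ik; rewrite ?mulr0 ?subr0 ?mulr1 //.
    by rewrite nth_default // sk.
  by rewrite ik subrr.
(* The leading term c X^k is traded for c m0 X^(k - d): same value at [a], smaller degree, no larger
   weighted norm. *)
pose t := m0 * 'X^(k - d).
have ht : poly_on D t by apply: poly_onM => //; exact: poly_onXn.
have hct : poly_on D (c%:P * t) by apply: poly_onM => //; exact: poly_onC.
have wp : wnorm N r p = wnorm N r p0 + N c * r ^+ k.
  have sp0 : (size p0 <= k)%N by apply/leq_sizeP => j kj; rewrite cp0 ltnNge kj.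
  rewrite (wnormE r sN sp0) /wnorm sk big_ord_recr /=; congr (_ + _).
  by apply: eq_bigr => i _; rewrite cp0 ltn_ord.
apply: (@le_trans _ _ (wnorm N r (p0 + c%:P * t))).
  apply: IH.
  - apply: (@leq_trans k); last by rewrite -ltnS -sk.
    apply/leq_sizeP => j kj; rewrite coefD cp0 ltnNge kj /= add0r coefCM coefMXn.
    case: ifP => [_|jk]; first by rewrite mulr0.
    by rewrite m0d ?mulr0 //; lia.
  - exact: poly_onD.
  - rewrite /p0 /t /m0 !(hornerD, hornerN, hornerM, hornerC, hornerXn) pa ma subr0.
    by rewrite -exprD subnKC //; ring.
rewrite wp; apply: (le_trans (wnormD sN r0 hp0 hct)); rewrite lerD2l.
apply: (le_trans (wnormCM sN r0 Dc ht)); apply: ler_wpM2l; first exact: Nge0.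
rewrite (wnormXn r sN) -{2}(subnKC dk) exprD; apply: ler_wpM2r => //.
by apply: exprn_ge0; exact: ltW.
Qed.

(** * A finest seminorm, and its multiplicativity *)

Section Extension.
Variables (R : realType) (K : set algC) (phi : algC -> R).
Hypotheses (rK : subring K) (QK : Qfield `<=` K) (avphi : is_absval K phi).

Let phi0 := absval0 rK avphi.
Let phi1 := absval1 rK avphi.
Let phi_ge0 := absval_ge0 avphi.
Let phiM := absvalM avphi.

(** The bound [1 <= DN.2 1] excludes the zero seminorm and survives infima along chains. *)
Definition dominated (DN : set algC * (algC -> R)) : Prop :=
  [/\ is_seminorm DN.1 DN.2, K `<=` DN.1,
      (forall x, K x -> DN.2 x <= phi x) & 1 <= DN.2 1].

(** One order for both enlarging the domain and lowering the seminorm, so that a maximal element is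
    extremal in both respects. *)
Definition finer (s t : {DN | dominated DN}) : Prop :=
  (sval s).1 `<=` (sval t).1 /\ forall x, (sval s).1 x -> (sval t).2 x <= (sval s).2 x.

Let finer_trans s t u : finer s t -> finer t u -> finer s u.
Proof.
move=> [st Nst] [tu Ntu]; split; first exact: subset_trans tu.
by move=> x sx; apply: le_trans (Nst _ sx); apply: Ntu; exact: st.
Qed.

(** Take the union of the domains and, at each x, the infimum over the members defined there. Two
    members have a common upper bound inside the chain, where each seminorm axiom can be checked. *)
Lemma finer_chain (A : set {DN | dominated DN}) : total_on A finer -> A !=set0 ->
  exists t, forall s, A s -> finer s t.
Proof.
move=> totA [t0 At0].
pose D := [set x | exists2 t, A t & (sval t).1 x].
pose E x := [set c | exists t, [/\ A t, (sval t).1 x & c = (sval t).2 x]].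
pose N x := inf (E x).
have common s t : A s -> A t -> exists u, [/\ A u, finer s u & finer t u].
  move=> As At; have [st|ts] := totA s t As At.
    by exists t; split => //; split.
  by exists s; split => //; split.
have tD (t : {DN | dominated DN}) : subring (sval t).1 by case: (svalP t) => -[].
have tge0 (t : {DN | dominated DN}) x : (sval t).1 x -> 0 <= (sval t).2 x.
  by case: (svalP t) => -[_ _ h _ _] _ _ _; exact: h.
have Elb x : lbound (E x) 0 by move=> _ [t [At tx ->]]; exact: tge0.
have EN0 x : D x -> E x !=set0 by move=> [t At tx]; exists ((sval t).2 x), t.
have Nle t x : A t -> (sval t).1 x -> N x <= (sval t).2 x.
  by move=> At tx; apply: ge_inf; [exists 0|exists t].
have KD : K `<=` D by move=> x Kx; exists t0 => //; case: (svalP t0) => _ h _ _; exact: h.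
have gD : dominated (D, N).
  split => //=.
  - split => //.
    + split; first by exists t0 => //; exact: (subring1 (tD t0)).
      * move=> x y [s As sx] [t At ty]; have [u [Au [su _] [tu _]]] := common s t As At.
        by exists u => //; apply: (subringB (tD u)); [exact: su|exact: tu].
      * move=> x y [s As sx] [t At ty]; have [u [Au [su _] [tu _]]] := common s t As At.
        by exists u => //; apply: (subringM (tD u)); [exact: su|exact: tu].
    + apply/eqP; rewrite eq_le; apply/andP; split.
        have := Nle t0 0 At0 (subring0 (tD t0)).
        by case: (svalP t0) => -[_ -> _ _ _].
      by apply: lb_le_inf => //; apply: EN0; exact: (KD _ (subring0 rK)).
    + by move=> x Dx; apply: lb_le_inf => //; exact: EN0.
    + move=> x y Dx Dy; apply: le_inf_add; [exact: EN0|exact: EN0|].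
      move=> _ _ [s [As sx ->]] [t [At ty ->]].
      have [u [Au [su Nsu] [tu Ntu]]] := common s t As At.
      apply: (le_trans (Nle u _ Au (subringD (tD u) (su _ sx) (tu _ ty)))).
      apply: le_trans (lerD (Nsu _ sx) (Ntu _ ty)).
      by case: (svalP u) => -[_ _ _ h _] _ _ _; apply: h; [exact: su|exact: tu].
    + move=> x y Dx Dy; apply: le_inf_mul => //; [exact: EN0|exact: EN0|].
      move=> _ _ [s [As sx ->]] [t [At ty ->]].
      have [u [Au [su Nsu] [tu Ntu]]] := common s t As At.
      apply: (le_trans (Nle u _ Au (subringM (tD u) (su _ sx) (tu _ ty)))).
      have h1 : 0 <= (sval u).2 x by apply: tge0; exact: su.
      have h2 : 0 <= (sval u).2 y by apply: tge0; exact: tu.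
      apply: le_trans (ler_pM h1 h2 (Nsu _ sx) (Ntu _ ty)).
      by case: (svalP u) => -[_ _ _ _ h] _ _ _; apply: h; [exact: su|exact: tu].
  - move=> x Kx; case: (svalP t0) => _ h1 h2 _.
    by apply: (le_trans (Nle t0 _ At0 (h1 _ Kx))); exact: h2.
  - apply: lb_le_inf; first by apply: EN0; exact: (KD _ (subring1 rK)).
    by move=> _ [t [At _ ->]]; case: (svalP t).
exists (exist _ (D, N) gD) => s As; split => /=; first by move=> x sx; exists s.
by move=> x sx; exact: Nle.
Qed.

Lemma exists_finest : exists DN, dominated DN /\
  forall DN', dominated DN' -> DN.1 `<=` DN'.1 -> (forall x, DN.1 x -> DN'.2 x <= DN.2 x) ->
    DN'.1 `<=` DN.1 /\ forall x, DN'.1 x -> DN.2 x <= DN'.2 x.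
Proof.
have g0 : dominated (K, phi).
  split => //=; last by rewrite phi1.
  split => //; first by case: avphi => _ _ _; exact.
  by move=> x y Kx Ky; rewrite phiM.
pose t0 : {DN | dominated DN} := exist _ _ g0.
have [|||t tmax] := @ZL_preorder _ t0 (fun s t => `[< finer s t >]).
- by move=> s; apply/asboolP; split.
- by move=> s t u /asboolP st /asboolP tu; apply/asboolP; exact: finer_trans tu.
- move=> A totA; have [A0|A0] := pselect (A !=set0).
    have [|t ht] := @finer_chain A _ A0.
      by move=> s u As Au; have [/asboolP|/asboolP] := totA s u As Au; [left|right].
    by exists t => s As; apply/asboolP; exact: ht.
  by exists t0 => s As; case: A0; exists s.
exists (sval t); split; first exact: svalP.
move=> DN' gDN' sub le; have := tmax (exist _ _ gDN').
have h : `[< finer t (exist _ DN' gDN') >] by apply/asboolP; split.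
by move=> /(_ h)/asboolP[].
Qed.

(* The three properties of a finest seminorm (everywhere defined,
   power-multiplicative, multiplicative) are all obtained from this lemma, by
   adjoining some a with a prescribed bound r on its norm. *)
Lemma finest_bound D N : dominated (D, N) ->
  (forall DN', dominated DN' -> D `<=` DN'.1 -> (forall x, D x -> DN'.2 x <= N x) ->
    DN'.1 `<=` D /\ forall x, DN'.1 x -> N x <= DN'.2 x) ->
  forall a r c, 0 < r -> 0 < c ->
  (forall p, poly_on D p -> p.[a] = 1 -> c <= wnorm N r p) -> D a /\ N a <= r.
Proof.
move=> [/= sN KD Nphi N1] finest a r c r0 c0 lb.
have rD : subring D by case: sN.
have sQ := qnorm_seminorm sN r0 a.
have [|||sub le] := finest (adjoin D a, qnorm D N r a).
- split => //=.
  + by move=> x Kx; apply: adjoin_id => //; exact: KD.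
  + move=> x Kx; apply: le_trans (Nphi _ Kx).
    have := qnorm_le sN r0 a (poly_onC rD (KD _ Kx)).
    by rewrite (wnormC r sN) ?hornerC.
  (* Any positive lower bound is enough: [q <= q * q] with [q > 0] gives [1 <= q]. *)
  + have q1 : c <= qnorm D N r a 1.
      by apply: qnorm_ge => //; apply: adjoin_id => //; exact: subring1.
    have A1 : adjoin D a 1 by apply: adjoin_id => //; exact: subring1.
    case: sQ => _ _ _ _ /(_ 1 1 A1 A1); rewrite mulr1.
    by rewrite ler_pMl //; exact: lt_le_trans q1.
- by move=> x Dx; exact: adjoin_id.
- move=> x Dx /=; have := qnorm_le sN r0 a (poly_onC rD Dx).
  by rewrite (wnormC r sN) ?hornerC.
have Da : adjoin D a a by exact: adjoin_gen.
split; first exact: sub.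
apply: (le_trans (le _ Da)) => /=.
have := qnorm_le sN r0 a (poly_onXn rD 1); rewrite hornerXn expr1 => /le_trans; apply.
have := wnormMX r sN 1; rewrite mul1r expr1 => ->.
have := wnormC r sN 1; rewrite polyC1 => ->.
rewrite -[leRHS]mul1r; apply: ler_wpM2r; first exact: ltW.
by rewrite -phi1; apply: Nphi; exact: subring1.
Qed.

Theorem absval_extension : exists psi : algC -> R,
  is_absval setT psi /\ forall x, K x -> psi x = phi x.
Proof.
have [[D N] [dDN finest]] := exists_finest.
have bound := finest_bound dDN finest.
case: dDN => /= sN KD Nphi N1 {finest}.
have [rD N0 Nge0 ND NM] := sN.
have QD : Qfield `<=` D by exact: subset_trans KD.
have DT a : D a.
  have [r r0 lb] := wnorm_lower_bound sN QD a.
  by have [] := bound a r 1 r0 ltr01 (fun p hp pa => le_trans N1 (lb p hp pa)).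
have N_gt0 a : a != 0 -> 0 < N a.
  move=> a0; have := le_trans N1 _; move=> /(_ (N a * N a^-1)).
  rewrite -[X in N X](divff a0) NM // => /(_ isT) h.
  have := Nge0 a (DT a); rewrite le_eqVlt => /predU1P[e|//].
  by move: h; rewrite -e mul0r ler10.
have N11 : N 1 = 1.
  by apply/eqP; rewrite eq_le N1 andbT -phi1; apply: Nphi; exact: subring1.
have NX a n : N (a ^+ n) <= N a ^+ n.
  elim: n => [|n IH]; first by rewrite !expr0 N11.
  rewrite !exprS; apply: (le_trans (NM _ _ (DT _) (DT _))).
  by apply: ler_wpM2l => //; exact: Nge0.
have N2 a : N a ^+ 2 <= N (a ^+ 2).
  have [->|a0] := eqVneq a 0; first by rewrite expr0n /= N0 expr0n.
  have Na2 : 0 < N (a ^+ 2) by apply: N_gt0; rewrite expf_neq0.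
  set r := Num.sqrt (N (a ^+ 2)).
  have r0 : 0 < r by rewrite sqrtr_gt0.
  have r2 : r ^+ 2 = N (a ^+ 2) by rewrite sqr_sqrtr // ltW.
  have [h|ar] := lerP (N a) r.
    by rewrite -r2 ler_pXn2r // nnegrE ?Nge0 // ltW.
  have Nev j : N (a ^+ (j.*2)) <= r ^+ (j.*2).
    by rewrite -!muln2 !(mulnC _ 2) !exprM r2 NX.
  (* Even powers are controlled through [a ^+ 2], and an odd one costs one factor [N a / r]. So p(a)
     = 1 forces a weighted norm of at least [r / N a], and [bound] yields [N a <= r], contradicting
     [ar]. *)
  have Ni i : N (a ^+ i) <= N a / r * r ^+ i.
    rewrite -(odd_double_half i); case: (odd i) => /=.
      rewrite add1n !exprS mulrA divfK ?gt_eqF //.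
      by apply: (le_trans (NM _ _ (DT _) (DT _))); apply: ler_wpM2l => //; exact: Nge0.
    rewrite add0n; apply: (le_trans (Nev _)); rewrite ler_peMl ?exprn_ge0 ?ltW //.
    by rewrite ltr_pdivlMr // mul1r.
  have Nar : 0 < N a / r by rewrite divr_gt0 // N_gt0.
  have [||_] := bound a r (N a / r)^-1 r0; first by rewrite invr_gt0.
    move=> p hp pa; rewrite -[leLHS]mulr1 ler_pdivrMl // -{1}N11 -pa horner_coef.
    apply: (le_trans (seminorm_sum sN _ _)) => //.
    rewrite /wnorm mulr_sumr; apply: ler_sum => i _.
    apply: (le_trans (NM _ _ (DT _) (DT _))).
    by rewrite mulrCA; apply: ler_wpM2l; [exact: Nge0|exact: Ni].
  by rewrite leNgt ar.
have N2k a k : N a ^+ (2 ^ k) <= N (a ^+ (2 ^ k)).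
  elim: k => [|k IH]; first by rewrite !expr1.
  rewrite expnSr !exprM; apply: le_trans (N2 _).
  by rewrite ler_pXn2r // nnegrE ?exprn_ge0 ?Nge0.
have NV a : a != 0 -> N a^-1 <= (N a)^-1.
  move=> a0; have Na0 := N_gt0 _ a0.
  have [|//||_ //] := bound a^-1 (N a)^-1 1; first by rewrite invr_gt0.
  (* Multiplying p(1/a) = 1 by [a ^+ M] clears the denominators; [M] is a power of two so that [N2k]
     bounds [N (a ^+ M)] from below. *)
  move=> p hp pa; set M := (2 ^ size p)%N.
  have pM (i : 'I_(size p)) : (i <= M)%N.
    by apply: (leq_trans (ltnW (ltn_ord i))); exact/ltnW/ltn_expl.
  have aM : a ^+ M = \sum_(i < size p) p`_i * a ^+ (M - i).
    rewrite -[LHS]mul1r -pa horner_coef mulr_suml; apply: eq_bigr => i _.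
    by rewrite -mulrA exprVn expfB_cond ?(negbTE a0) ?pM // [_ ^- _ * _]mulrC.
  have NaM : 0 < N a ^+ M by exact: exprn_gt0.
  rewrite -(ler_pM2r NaM) mul1r; apply: (le_trans (N2k _ _)).
  rewrite -/M aM; apply: (le_trans (seminorm_sum sN _ _)) => //.
  rewrite /wnorm mulr_suml; apply: ler_sum => i _.
  apply: (le_trans (NM _ _ (DT _) (DT _))); rewrite -mulrA; apply: ler_wpM2l; first exact: Nge0.
  apply: (le_trans (NX _ _)).
  by rewrite exprVn expfB_cond ?gt_eqF ?pM // mulrC.
have NMul x y : N (x * y) = N x * N y.
  have [->|x0] := eqVneq x 0; first by rewrite mul0r N0 mul0r.
  apply/eqP; rewrite eq_le NM //= mulrC -ler_pdivlMr ?N_gt0 //.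
  rewrite -{1}[y](mulKf x0) mulrC; apply: (le_trans (NM _ _ (DT _) (DT _))).
  by apply: ler_wpM2l; [exact: Nge0|exact: NV].
exists N; split.
  split => //; first by move=> x _; exact: Nge0.
  - move=> x _; split=> [Nx|-> //]; apply/eqP; apply: contra_eqT Nx => x0.
    by rewrite gt_eqF // N_gt0.
  - by move=> x y _ _; exact: ND.
(* On [K], the inequality between [N] and [phi] holds at [x] and at its inverse; both functions
   being multiplicative, it is an equality. *)
move=> x Kx; apply/eqP; rewrite eq_le Nphi //=.
have [->|x0] := eqVneq x 0; first by rewrite phi0 N0.
have Kx1 : K x^-1 by exact: subringV.
have le1 := Nphi _ Kx1; have Nx := ltW (N_gt0 _ x0).
have e1 : N x * N x^-1 = 1 by rewrite -NMul divff.
have e2 : phi x * phi x^-1 = 1 by rewrite -phiM // divff.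
have h : 0 <= phi x by exact: phi_ge0.
rewrite -[leLHS]mulr1 -e1 -[leRHS]mulr1 -e2 mulrCA.
by apply: ler_wpM2l => //; exact: ler_wpM2l.
Qed.

End Extension.

(** * Places and finiteness of the set of places above a place *)

(** Closure under inverses follows by [subringV]. *)
Definition subfield (K : set algC) : Prop := subring K /\ Qfield `<=` K.

Lemma number_field_subfield K : is_number_field K -> subfield K.
Proof.
move=> [[K0 K1] KB KM KV _]; have rK : subring K by [].
split=> // x /CratP[q ->]; rewrite /ratr.
have Kint (z : int) : K z%:~R.
  by case: z => n; rewrite ?NegzE ?mulrNz; [|apply: subringN => //]; exact: subring_nat.
by apply: KM => //; exact: KV.
Qed.

Section Places.
Variable R : realType.
Implicit Types (K L : set algC) (phi psi : algC -> R) (v w : set (algC -> R)).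

Definition place_of K phi : set (algC -> R) :=
  [set psi | is_absval K psi /\ absval_equiv K phi psi].

Lemma place_of_id K phi : is_absval K phi -> place_of K phi phi.
Proof.
move=> av; split=> //; exists 1; split=> // x Kx.
by rewrite powRr1 //; case: av => h _ _ _; exact: h.
Qed.

Lemma absval_equiv_sym K phi psi : is_absval K phi ->
  absval_equiv K phi psi -> absval_equiv K psi phi.
Proof.
move=> [h _ _ _] [t [t0 e]]; exists t^-1; split; first by rewrite invr_gt0.
by move=> x Kx; rewrite e // powRK // h.
Qed.

Lemma absval_equiv_trans K phi psi chi :
  absval_equiv K phi psi -> absval_equiv K psi chi -> absval_equiv K phi chi.
Proof.
move=> [t [t0 et]] [u [u0 eu]]; exists (t * u); split; first exact: mulr_gt0.
by move=> x Kx; rewrite eu // et // powRrM.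
Qed.

Lemma place_ofP K v psi : is_place K v -> v psi ->
  [/\ is_absval K psi, nontrivial_absval K psi & v = place_of K psi].
Proof.
move=> [phi [av [x [Kx x0 px1]] ->]] [av' eq]; split => //.
- exists x; split=> //; case: eq => t [t0 ->] //.
  rewrite powR_eq1 (negbTE px1) gt_eqF //= orbF -leNgt.
  by case: av => h _ _ _; exact: h.
- apply/seteqP; split=> chi [avc eqc]; split=> //.
    exact: absval_equiv_trans (absval_equiv_sym av eq) eqc.
  exact: absval_equiv_trans eq eqc.
Qed.

Lemma place_nonempty K v : is_place K v -> exists phi, v phi.
Proof. by move=> [phi [av _ ->]]; exists phi; exact: place_of_id. Qed.

Lemma place_eq K v v' psi : is_place K v -> is_place K v' -> v psi -> v' psi -> v = v'.
Proof. by move=> pv pv' /(place_ofP pv)[_ _ ->] /(place_ofP pv')[_ _ ->]. Qed.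

Lemma is_place_place_of K phi :
  is_absval K phi -> nontrivial_absval K phi -> is_place K (place_of K phi).
Proof. by move=> av nt; exists phi. Qed.

Lemma nontrivial_sub K L phi : K `<=` L -> nontrivial_absval K phi -> nontrivial_absval L phi.
Proof. by move=> KL [x [/KL Lx x0 px]]; exists x. Qed.

(** One common absolute value suffices, because an equivalence over [L] restricts to [K] with the
    same exponent. *)
Lemma place_above_of K L v w psi : K `<=` L -> is_place K v -> is_place L w ->
  w psi -> v psi -> place_above w v.
Proof.
move=> KL pv pw /(place_ofP pw)[_ _ ->] /(place_ofP pv)[_ _ ->] chi [avc [t [t0 e]]].
by split; [exact: absval_sub avc|exists t; split=> // x /KL; exact: e].
Qed.

Lemma absval_eq_on K phi psi : (forall x, K x -> psi x = phi x) -> subring K ->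
  is_absval K phi -> is_absval K psi.
Proof.
move=> e rK [h1 h2 h3 h4]; split.
- by move=> x Kx; rewrite e // h1.
- by move=> x Kx; rewrite e // h2.
- by move=> x y Kx Ky; rewrite !e // ?h3 //; exact: subringM.
- by move=> x y Kx Ky; rewrite !e // ?h4 //; exact: subringD.
Qed.

Lemma place_of_eq_on K v phi psi : subring K -> is_place K v -> v phi ->
  (forall x, K x -> psi x = phi x) -> v psi.
Proof.
move=> rK pv vphi e; have [av _ ->] := place_ofP pv vphi.
have [_ [t [t0 et]]] := place_of_id av.
split; first exact: absval_eq_on av.
by exists t; split=> // x Kx; rewrite e //; exact: et.
Qed.

(** Some power of any member of [w] agrees with [phi] on [K]. Its triangle inequality comes from
    [absval_powR], since on naturals it equals [phi]. *)
Lemma place_normalize K L v w phi : subfield K -> subfield L -> K `<=` L ->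
  is_place K v -> is_place L w -> v phi -> place_above w v ->
  exists psi, w psi /\ forall x, K x -> psi x = phi x.
Proof.
move=> [rK QK] [rL QL] KL pv pw vphi wv.
have [psi0 wpsi0] := place_nonempty pw.
have [av _ vE] := place_ofP pv vphi.
have [av0 _ wE] := place_ofP pw wpsi0.
have := wv _ wpsi0; rewrite vE => -[_ [t [t0 e]]].
have eK x : K x -> psi0 x `^ t^-1 = phi x.
  by move=> Kx; rewrite e // powRK // (absval_ge0 av).
exists (fun x => psi0 x `^ t^-1); split => //; rewrite wE; split.
  apply: absval_powR => //; first by rewrite invr_gt0.
  by move=> n; rewrite eK; [exact: (absval_nat rK av)|exact: subring_nat].
by exists t^-1; split => //; rewrite invr_gt0.
Qed.

End Places.

(** * Finiteness of the set of places above a place *)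

Section Finiteness.
Variables (R : realType) (L : set algC).
Hypothesis nfL : is_number_field L.

Let rL : subring L. Proof. by case: (number_field_subfield nfL). Qed.
Let QL : Qfield `<=` L. Proof. by case: (number_field_subfield nfL). Qed.

(** The first m + 1 powers of x lie in the span of m elements, so their coefficient matrix has a
    nonzero left kernel. The length of the relation depends on [L] only, which makes the pigeonhole
    bound uniform. *)
Lemma number_field_relation : exists m, forall x, L x ->
  exists q : 'I_m.+1 -> rat, (exists k, q k != 0) /\ \sum_k ratr (q k) * x ^+ k = 0.
Proof.
case: nfL => _ _ _ _ [s [sL span]]; exists (size s) => x Lx.
have span' (k : 'I_(size s).+1) : exists c : 'I_(size s) -> rat,
    x ^+ k = \sum_i ratr (c i) * s`_i.
  have [c [sc cQ ->]] := span _ (subringX rL k Lx).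
  have : forall i : 'I_(size s), exists a : rat, c`_i = ratr a.
    by move=> i; apply/CratP; apply: (allP cQ); apply: mem_nth; rewrite sc.
  by move=> /choice[f fE]; exists f; apply: eq_bigr => i _; rewrite fE.
have [c cE] := choice span'.
pose A : 'M[rat]_((size s).+1, size s) := \matrix_(k, i) c k i.
have kerA : kermx A != 0.
  rewrite kermx_eq0 /row_free; apply/eqP => rA.
  by have := rank_leq_col A; rewrite rA ltnn.
pose u := nz_row (kermx A).
have u0 : u != 0 by rewrite nz_row_eq0.
have uA : u *m A = 0 by apply/sub_kermxP; exact: nz_row_sub.
exists (fun k => u 0 k); split.
  by have /matrix0Pn[i [j]] := u0; rewrite ord1 => uj; exists j.
under eq_bigr => k _ do rewrite cE mulr_sumr.
rewrite exchange_big /= big1 // => i _.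
under eq_bigr => k _ do rewrite mulrA -rmorphM.
rewrite -mulr_suml -rmorph_sum; have /matrixP/(_ 0 i) := uA; rewrite !mxE.
under eq_bigr => k _ do rewrite mxE.
by move=> ->; rewrite raddf0 mul0r.
Qed.

(** Let [k] index the largest value. If each of the m others were below T k / (m + 1), their sum
    could not reach [T k]. *)
Lemma dominant_pair m (T : 'I_m.+1 -> R) : (exists k, 0 < T k) ->
  (forall k, T k <= \sum_(l | l != k) T l) ->
  exists k l, [/\ l != k, 0 < T k, T l <= T k & T k <= m.+1%:R * T l].
Proof.
move=> [k0 Tk0] sumT.
case: (@Order.TotalTheory.arg_maxP _ R _ k0 xpredT T erefl) => k _ kmax.
have Tk : 0 < T k by exact: lt_le_trans (kmax k0 isT).
have [[l [lk h]]|none] := pselect (exists l, l != k /\ T k <= m.+1%:R * T l).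
  by exists k, l; split => //; exact: kmax.
have small l : l != k -> m.+1%:R * T l <= T k.
  by move=> lk; rewrite leNgt; apply/negP => h; apply: none; exists l; split => //; exact: ltW.
have : m.+1%:R * T k <= \sum_(l | l != k) T k.
  apply: (le_trans (ler_wpM2l _ (sumT k))) => //.
  by rewrite mulr_sumr; apply: ler_sum => l; exact: small.
rewrite sumr_const cardC1 card_ord /= -[in leRHS]mulr_natl -natr1 mulrDl mul1r gerDl.
by rewrite leNgt Tk.
Qed.

(* A group is not covered by finitely many proper subgroups with torsion-free
   quotients, here the subgroups {psi = psi'}. *)
Lemma separating_element (I : eqType) (s : seq I) (p p' : I -> algC -> R) :
  (forall i, i \in s ->
    [/\ is_absval L (p i), is_absval L (p' i) & exists2 x, L x & p i x != p' i x]) ->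
  exists z, [/\ L z, z != 0 & forall i, i \in s -> p i z != p' i z].
Proof.
elim: s => [|j s IH] h.
  by exists 1; split => //; [exact: subring1|exact: oner_neq0].
have [i si|z [Lz z0 hz]] := IH; first by apply: h; rewrite inE si orbT.
have [av av' [w Lw pw]] := h j (mem_head _ _).
have [pz|pz] := eqVneq (p j z) (p' j z); last first.
  by exists z; split => // i; rewrite inE => /predU1P[->|/hz].
have w0 : w != 0.
  by apply: contra_neq pw => ->; rewrite (absval0 rL av) (absval0 rL av').
(* For large n, replacing z by z^n w keeps the pairs already separated apart; the new pair agrees at
   z and differs at w, so it is separated for every n. *)
have [k hk] : exists k, forall n, (k <= n)%N -> forall i, i \in s ->
    p i (z ^+ n * w) != p' i (z ^+ n * w).
  have : forall i, exists k, i \in s -> forall n, (k <= n)%N ->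
      p i (z ^+ n * w) != p' i (z ^+ n * w).
    move=> i; case: (boolP (i \in s)) => [si|]; last by exists 0%N.
    have [|ai ai' _] := h i; first by rewrite inE si orbT.
    have [k hk] := eventually_expr_neq (absval_gt0 ai Lz z0) (absval_gt0 ai' Lz z0)
                     (absval_gt0 ai Lw w0) (absval_gt0 ai' Lw w0) (hz i si).
    exists k => _ n kn /=; have Lzn := subringX rL n Lz.
    by rewrite (absvalM ai) // (absvalM ai') // (absvalX rL ai) // (absvalX rL ai') // hk.
  move=> /choice[f hf]; exists (\max_(i <- s) f i)%N => n kn i si.
  by apply: hf => //; apply: leq_trans kn; exact: leq_bigmax_seq.
have Lzk := subringX rL k Lz.
exists (z ^+ k * w); split.
- exact: subringM.
- by rewrite mulf_neq0 // expf_neq0.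
- move=> i; rewrite inE => /predU1P[->|]; last exact: hk.
  rewrite (absvalM av) // (absvalM av') // (absvalX rL av) // (absvalX rL av') // pz.
  by apply: contra_neq pw => /mulfI; apply; rewrite expf_neq0 // gt_eqF // (absval_gt0 av').
Qed.

(* If x = z^N is a root of sum_k q_k X^k, then for each psi two terms of the sum
   are comparable up to a factor m + 1, and for large N the indices of these
   two terms determine psi. *)
Lemma absvals_over_Q_bound : exists B, forall n (psi : 'I_n -> algC -> R),
  (forall i, is_absval L (psi i)) ->
  (forall i j x, Qfield x -> psi i x = psi j x) ->
  (forall i j, i != j -> exists2 x, L x & psi i x != psi j x) -> (n <= B)%N.
Proof.
(* The bound is the number of pairs of term indices in the relation. *)
have [m rel] := number_field_relation; exists (m.+1 * m.+1)%N => n psi av agree dist.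
have [|z [Lz z0 hz]] := @separating_element _ [seq p <- enum {: 'I_n * 'I_n} | p.1 != p.2]
    (fun p => psi p.1) (fun p => psi p.2).
  by move=> [i j]; rewrite mem_filter /= => /andP[ij _]; split => //; exact: dist.
have sep i j : i != j -> psi i z != psi j z.
  by move=> ij; apply: (hz (i, j)); rewrite mem_filter ij mem_enum.
have pz i : 0 < psi i z by exact: (absval_gt0 (av i)).
(* [N] amplifies each gap between values at z beyond the factor m + 1 lost in [dominant_pair]. *)
have [N hN] : exists N, forall i j, psi i z < psi j z ->
    m.+1%:R * psi i z ^+ N < psi j z ^+ N.
  have : forall p : 'I_n * 'I_n, exists k, psi p.1 z < psi p.2 z ->
      forall N, (k <= N)%N -> m.+1%:R * psi p.1 z ^+ N < psi p.2 z ^+ N.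
    move=> [i j] /=; case: (ltP (psi i z) (psi j z)) => [ij|]; last by exists 0%N.
    have [|k hk] := @expr_unbounded R (psi j z / psi i z) m.+1%:R.
      by rewrite ltr_pdivlMr // mul1r.
    exists k => _ N kN; have := hk N kN.
    by rewrite expr_div_n ltr_pdivlMr // exprn_gt0.
  move=> /choice[f hf]; exists (\max_p f p)%N => i j ij.
  by apply: (hf (i, j)) => //; exact: (leq_bigmax (i, j)).
have Lx := subringX rL N Lz; set x := z ^+ N in Lx.
have [q [[k0 qk0] q0]] := rel x Lx.
have Lq k : L (ratr (q k)) by apply: QL; exact: Qfield_ratr.
have px i : 0 < psi i x by rewrite (absvalX rL (av i)) // exprn_gt0.
have : forall i, exists kl : 'I_m.+1 * 'I_m.+1, let: (k, l) := kl in
   let P := psi i (ratr (q k)) in let Q := psi i (ratr (q l)) in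
   [/\ l != k, 0 < Q, Q * psi i x ^+ l <= P * psi i x ^+ k &
     P * psi i x ^+ k <= m.+1%:R * (Q * psi i x ^+ l)].
  move=> i; pose T k := psi i (ratr (q k)) * psi i x ^+ k.
  have TE (k : 'I_m.+1) : psi i (ratr (q k) * x ^+ k) = T k.
    have Lxk := subringX rL k Lx.
    by rewrite (absvalM (av i)) // (absvalX rL (av i)).
  have Lt (k : 'I_m.+1) : L (ratr (q k) * x ^+ k).
    by apply: subringM => //; exact: (subringX rL).
  have [||k [l [lk Tk h1 h2]]] := @dominant_pair m T.
  - exists k0; rewrite mulr_gt0 ?exprn_gt0 //; apply: (absval_gt0 (av i)) => //.
    by rewrite fmorph_eq0.
  - move=> k; rewrite -TE; move: q0; rewrite (bigD1 k) //= => /eqP.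
    rewrite addr_eq0 => /eqP ->; rewrite (absvalN rL (av i)); last exact: subring_sum.
    apply: (le_trans (absval_sum rL (av i) _ _ Lt)).
    by apply: ler_sum => l _; rewrite TE.
  exists (k, l); split => //.
  have : 0 < T l.
    have := lt_le_trans Tk h2; rewrite pmulr_rgt0 //.
  by rewrite pmulr_lgt0 // exprn_gt0.
move=> /choice[f hf].
suff finj : injective f by have := leq_card f finj; rewrite card_prod !card_ord.
suff key i j : psi i z < psi j z -> f i <> f j.
  move=> i j fij; apply/eqP/negPn/negP => ij; have := sep i j ij.
  by rewrite neq_lt => /orP[/key|/key]; [apply|apply; exact: esym].
(* With a common pair (k, l), P and Q are common too, as the absolute values agree on Q. Then P/Q
   lies between u^(l-k) and (m+1) u^(l-k), and likewise for v, which [uvd] rules out whichever of k,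
   l is larger. *)
move=> ij fij; have := hf i; have := hf j; rewrite -fij; case: (f i) => k l.
rewrite !(agree j i (ratr _) (Qfield_ratr _)) /=.
set P := psi i (ratr (q k)); set Q := psi i (ratr (q l)); set u := psi i x; set v := psi j x.
move=> [lk Q0 vl vu] [_ _ ul uu].
have u0 : 0 < u by exact: px.
have v0 : 0 < v by exact: px.
have P0 : 0 <= P by exact: (absval_ge0 (av i)).
have uv : m.+1%:R * u < v.
  by rewrite /u /v (absvalX rL (av i)) // (absvalX rL (av j)) //; exact: hN.
have m1 : 1 <= m.+1%:R :> R by rewrite ler1n.
have uvd d : (0 < d)%N -> m.+1%:R * u ^+ d < v ^+ d.
  case: d => // d _; apply: (@le_lt_trans _ _ ((m.+1%:R * u) ^+ d.+1)).
    rewrite exprMn; apply: ler_wpM2r; first by rewrite exprn_ge0 // ltW.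
    by rewrite -[leLHS]expr1 ler_weXn2l.
  by rewrite ltrXn2r // ?mulr_ge0 // ltW.
move: lk; rewrite neq_ltn => /orP[lk|kl].
- pose d := (k - l)%N; have d0 : (0 < d)%N by rewrite subn_gt0.
  have kE : nat_of_ord k = (d + l)%N by rewrite subnK // ltnW.
  have e1 : Q <= P * u ^+ d.
    by move: ul; rewrite kE exprD mulrA (ler_pM2r (exprn_gt0 _ u0)).
  have e2 : P * v ^+ d <= m.+1%:R * Q.
    by move: vu; rewrite kE exprD !mulrA; rewrite (ler_pM2r (exprn_gt0 _ v0)).
  have P1 : 0 < P.
    rewrite lt_neqAle P0 andbT; apply/eqP => Pz.
    by move: e1; rewrite -Pz mul0r leNgt Q0.
  have := uvd d d0; rewrite -(ltr_pM2l P1) => /lt_le_trans/(_ e2).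
  by rewrite mulrCA ltr_pM2l // ltNge e1.
- pose d := (l - k)%N; have d0 : (0 < d)%N by rewrite subn_gt0.
  have lE : nat_of_ord l = (d + k)%N by rewrite subnK // ltnW.
  have e1 : Q * v ^+ d <= P.
    by move: vl; rewrite lE exprD mulrA (ler_pM2r (exprn_gt0 _ v0)).
  have e2 : P <= m.+1%:R * (Q * u ^+ d).
    by move: uu; rewrite lE exprD !mulrA; rewrite (ler_pM2r (exprn_gt0 _ u0)).
  have := uvd d d0; rewrite -(ltr_pM2l Q0) => /lt_le_trans/(_ e1).
  by rewrite mulrCA => /lt_le_trans/(_ e2); rewrite ltxx.
Qed.

(** Representatives of the places above [v] can be normalized to agree on [K], hence on Q. Distinct
    places then give functions that differ on [L], and [absvals_over_Q_bound] applies. *)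
Lemma finite_places_above K v : subfield K -> K `<=` L -> is_place K v ->
  finite_set [set w : set (algC -> R) | is_place L w /\ place_above w v].
Proof.
move=> sK KL pv; apply/not_notP => inf; have [B hB] := absvals_over_Q_bound.
have [A subA] := @infinite_set_fset _ _ B.+1 inf; rewrite leqNgt => /negP; apply.
rewrite ltnS; set s := finmap.enum_fset A.
have sA i : (i < size s)%N -> is_place L (nth set0 s i) /\ place_above (nth set0 s i) v.
  by move=> si; apply: subA; rewrite /=; exact: mem_nth.
have [phi vphi] := place_nonempty pv.
have : forall i : 'I_(size s), exists psi, nth set0 s i psi /\ forall x, K x -> psi x = phi x.
  move=> i; have [pw wv] := sA i (ltn_ord i).
  by apply: (@place_normalize R K L v) => //; split.
move=> /choice[psi hpsi]; apply: (hB (size s) psi).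
- by move=> i; have [pw _] := sA i (ltn_ord i); case: (place_ofP pw (hpsi i).1).
- by move=> i j x Qx; rewrite !(hpsi _).2 //; apply: sK.2.
move=> i j ij; apply: contrapT => same.
have e x : L x -> psi i x = psi j x.
  by move=> Lx; apply/eqP/negPn/negP => h; apply: same; exists x.
have [pwi _] := sA i (ltn_ord i); have [pwj _] := sA j (ltn_ord j).
have : nth set0 s i = nth set0 s j.
  apply: (place_eq pwi pwj (hpsi i).1).
  exact: (place_of_eq_on rL pwj (hpsi j).1).
move=> /eqP; rewrite nth_uniq ?finmap.fset_uniq //; exact/negP.
Qed.

End Finiteness.

(** * A tower of number fields exhausting the algebraic numbers *)

Definition rat_span (s : seq algC) : set algC :=
  [set x | exists c : seq algC, [/\ size c = size s, all (mem Crat) c &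
     x = \sum_(i < size s) c`_i * s`_i]].

Lemma rat_spanP s x : rat_span s x <->
  exists f : nat -> algC, (forall i, f i \in Crat) /\ x = \sum_(i < size s) f i * s`_i.
Proof.
split=> [[c [sc cQ ->]]|[f [fQ ->]]].
  exists (nth 0 c); split=> // i; have [ic|ic] := ltnP i (size c).
    by apply: (allP cQ); exact: mem_nth.
  by rewrite nth_default // rpred0.
exists (mkseq f (size s)); split; first by rewrite size_mkseq.
  by apply/allP => _ /mapP[i _ ->]; exact: fQ.
by apply: eq_bigr => i _; rewrite nth_mkseq.
Qed.

Lemma rat_span0 s : rat_span s 0.
Proof.
apply/rat_spanP; exists (fun=> 0); split=> [i|]; first exact: rpred0.
by rewrite big1 // => i _; rewrite mul0r.
Qed.

Lemma rat_spanD s x y : rat_span s x -> rat_span s y -> rat_span s (x + y).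
Proof.
move=> /rat_spanP[f [fQ ->]] /rat_spanP[g [gQ ->]]; apply/rat_spanP.
exists (fun i => f i + g i); split=> [i|]; first exact: rpredD.
by rewrite -big_split; apply: eq_bigr => i _; rewrite mulrDl.
Qed.

Lemma rat_spanZ s c x : c \in Crat -> rat_span s x -> rat_span s (c * x).
Proof.
move=> cQ /rat_spanP[f [fQ ->]]; apply/rat_spanP.
exists (fun i => c * f i); split=> [i|]; first exact: rpredM.
by rewrite mulr_sumr; apply: eq_bigr => i _; rewrite mulrA.
Qed.

Lemma rat_span_sum s I (r : seq I) (F : I -> algC) :
  (forall i, rat_span s (F i)) -> rat_span s (\sum_(i <- r) F i).
Proof. by move=> h; apply: big_ind => //; [exact: rat_span0|exact: rat_spanD]. Qed.

Lemma rat_span_mem s x : x \in s -> rat_span s x.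
Proof.
move=> xs; apply/rat_spanP; exists (fun i => (i == index x s)%:R); split=> [i|].
  by apply: rpred_nat.
have ix : (index x s < size s)%N by rewrite index_mem.
rewrite (bigD1 (Ordinal ix)) //= eqxx mul1r nth_index // big1 ?addr0 // => i.
by rewrite -val_eqE /= => /negbTE ->; rewrite mul0r.
Qed.

(** Products of a spanning family of [K] with the powers of [a] below the degree of its minimal
    polynomial span; higher powers are reduced by strong induction. *)
Lemma adjoin_number_field K a : is_number_field K -> is_number_field (adjoin K a).
Proof.
move=> nfK; have [rK QK] := number_field_subfield nfK.
have rA := adjoin_subring rK a.
have KA : K `<=` adjoin K a by move=> x; exact: adjoin_id.
split.
- by split; [exact: subring0|exact: subring1].
- by move=> x y; exact: subringB.
- by move=> x y; exact: subringM.
- by move=> x; apply: subringV => //; exact: subset_trans KA.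
case: nfK => _ _ _ _ [s [sK spanK]].
have [m [mE mmon] _] := minCpolyP a; pose d := (size m).-1.
pose s' := [seq x * a ^+ i | x <- s, i <- iota 0 d].
have small n y : (n < d)%N -> K y -> rat_span s' (y * a ^+ n).
  move=> nd /spanK[c [sc cQ ->]]; rewrite mulr_suml; apply: rat_span_sum => i.
  rewrite -mulrA; apply: rat_spanZ.
    by apply: (allP cQ); apply: mem_nth; rewrite sc.
  apply: rat_span_mem; apply/allpairsP; exists (s`_i, n); split => //=.
    exact: mem_nth.
  by rewrite mem_iota.
have red : a ^+ d = - \sum_(i < d) ratr m`_i * a ^+ i.
  have : (minCpoly a).[a] = 0 by exact/eqP/root_minCpoly.
  have sm : size m = d.+1 by rewrite prednK // size_poly_gt0 monic_neq0.
  rewrite mE horner_coef size_map_poly sm big_ord_recr /= coef_map /=.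
  have -> : m`_d = 1 by move/monicP: mmon; rewrite lead_coefE.
  rewrite rmorph1 mul1r addrC => /eqP; rewrite addr_eq0 => /eqP ->.
  by congr (- _); apply: eq_bigr => i _; rewrite coef_map.
have all n : forall y, K y -> rat_span s' (y * a ^+ n).
  have [k nk] := ubnP n; elim: k n nk => // k IH n nk y Ky.
  have [nd|dn] := ltnP n d; first exact: small.
  rewrite -(subnK dn) exprD red mulrN mulrN -mulN1r mulr_sumr mulr_sumr.
  apply: rat_spanZ; first by rewrite rpredN rpred1.
  apply: rat_span_sum => i; rewrite [a ^+ (n - d) * _]mulrCA [y * _]mulrCA.
  apply: rat_spanZ; first exact: Crat_rat.
  rewrite -exprD; apply: IH => //.
  by have := ltn_ord i; lia.
exists s'; split.
  move=> _ /allpairsP[[x i] [/= xs _ ->]]; rewrite inE; apply: subringM => //.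
    by apply: KA; have := sK _ xs; rewrite inE.
  by apply: (subringX rA); exact: adjoin_gen.
move=> _ [p [hp ->]]; rewrite horner_coef.
by have := @rat_span_sum s' _ (index_enum 'I_(size p)) (fun i : 'I__ => p`_i * a ^+ i)
  (fun i => all i _ (hp i)).
Qed.

Lemma Qfield_number_field : is_number_field Qfield.
Proof.
split; rewrite /Qfield /=.
- by rewrite rpred0 rpred1.
- by move=> x y; exact: rpredB.
- by move=> x y; exact: rpredM.
- by move=> x; rewrite rpredV.
exists [:: 1]; split; first by move=> x; rewrite !inE => /eqP->; exact: rpred1.
by move=> x xQ; exists [:: x]; rewrite /= xQ big_ord1 mulr1.
Qed.

(** As [algC] is countable, adjoining at stage k the number coded by k reaches every algebraic
    number; a code naming none adjoins 0, which changes nothing. *)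
Fixpoint tower (n : nat) : set algC :=
  if n is k.+1 then adjoin (tower k) (odflt 0 (unpickle k)) else Qfield.

Lemma tower_number_field n : is_number_field (tower n).
Proof.
by elim: n => [|n IH]; [exact: Qfield_number_field|exact: adjoin_number_field].
Qed.

Lemma tower_subring n : subring (tower n).
Proof. by case: (number_field_subfield (tower_number_field n)). Qed.

Lemma tower_mono m n : (m <= n)%N -> tower m `<=` tower n.
Proof.
elim: n => [|n IH]; first by rewrite leqn0 => /eqP ->.
rewrite leq_eqVlt => /predU1P[-> //|]; rewrite ltnS => /IH sub x /sub.
by apply: adjoin_id; exact: tower_subring.
Qed.

Lemma mem_tower x : tower (pickle x).+1 x.
Proof. by rewrite /= pickleK /=; apply: adjoin_gen; exact: tower_subring. Qed.

Lemma seq_tower (s : seq algC) : exists n, forall x, x \in s -> tower n x.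
Proof.
elim: s => [|a s [n hn]]; first by exists 0%N.
exists (maxn n (pickle a).+1) => x; rewrite inE => /predU1P[->|/hn].
  exact: (tower_mono (leq_maxr _ _) (mem_tower a)).
exact: tower_mono (leq_maxl _ _) _.
Qed.

Lemma number_field_sub_tower K : is_number_field K -> exists n, K `<=` tower n.
Proof.
move=> [_ _ _ _ [s [_ span]]]; have [n hn] := seq_tower s; exists n => x /span[c [sc cQ ->]].
have [rT QT] := number_field_subfield (tower_number_field n).
apply: subring_sum => // i _; apply: subringM => //; last by apply: hn; exact: mem_nth.
by apply: QT; apply: (allP cQ); apply: mem_nth; rewrite sc.
Qed.

(** * The space X and the functionals Phi *)

Section PlacesOfS.
Variables (R : realType) (S : set (set (algC -> R))).
Hypothesis placeS : forall s, S s -> is_place Qfield s.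
Implicit Types (K L : set algC) (phi psi : algC -> R) (u v w y : set (algC -> R)).

Lemma MS_place K v : MS S K v -> is_place K v. Proof. by case. Qed.

Lemma above_factor K L v w y M : K `<=` L -> is_place K v -> is_place L w -> is_place M y ->
  place_above y v -> place_above y w -> place_above w v.
Proof.
move=> KL pv pw py yv yw; have [psi ypsi] := place_nonempty py.
exact: (place_above_of KL pv pw (yw _ ypsi) (yv _ ypsi)).
Qed.

Lemma above_unique K L v v' w : is_place K v -> is_place K v' -> is_place L w ->
  place_above w v -> place_above w v' -> v = v'.
Proof.
move=> pv pv' pw wv wv'; have [psi wpsi] := place_nonempty pw.
exact: (place_eq pv pv' (wv _ wpsi) (wv' _ wpsi)).
Qed.

(** The restriction to [K] is nontrivial because it is already so on Q, where it represents a place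
    in [S]. With [L] the whole of Qbar, this says that the sets Y(K,v) cover X. *)
Lemma MS_restrict K L w : subfield K -> K `<=` L -> MS S L w ->
  exists v, MS S K v /\ place_above w v.
Proof.
move=> [rK QK] KL [pw [s Ss ws]]; have [psi wpsi] := place_nonempty pw.
have [av _ _] := place_ofP pw wpsi; have pS := placeS Ss.
have [_ ntQ _] := place_ofP pS (ws _ wpsi).
have avK := absval_sub KL av.
have pK : is_place K (place_of K psi) by apply: is_place_place_of => //; exact: nontrivial_sub ntQ.
have vpsi := place_of_id avK; exists (place_of K psi); split.
  by split => //; exists s => //; exact: (place_above_of QK pS pK vpsi (ws _ wpsi)).
exact: (place_above_of KL pK pw wpsi vpsi).
Qed.

Lemma MS_above K L v w : MS S K v -> is_place L w -> place_above w v -> MS S L w.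
Proof. by move=> [_ [s Ss vs]] pw wv; split => //; exists s => //; exact: subset_trans vs. Qed.

Lemma Ybasic_X K v y : MS S K v -> Ybasic v y -> Xset S y.
Proof. by move=> mv [py yv]; exact: (MS_above mv py yv). Qed.

Lemma Ybasic_nonempty K v : subfield K -> MS S K v -> exists y, Ybasic v y.
Proof.
move=> [rK QK] [pv _]; have [phi vphi] := place_nonempty pv.
have [av nt vE] := place_ofP pv vphi.
have [psi [avT e]] := absval_extension rK QK av.
have KT : K `<=` setT by [].
have ntT : nontrivial_absval setT psi.
  by case: nt => x [Kx x0 px]; exists x; split => //; rewrite e.
have pT := is_place_place_of avT ntT.
exists (place_of setT psi); split => //.
apply: (place_above_of KT pv pT (place_of_id avT)).
exact: (place_of_eq_on rK pv vphi).
Qed.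

Lemma Ybasic_refine K L v y : subfield L -> K `<=` L -> MS S K v -> Ybasic v y ->
  exists w, [/\ MS S L w, place_above w v & Ybasic w y].
Proof.
move=> sL KL mv yv; have Xy := Ybasic_X mv yv.
have [w [mw yw]] := @MS_restrict L setT y sL (fun _ _ => I) Xy.
exists w; split => //; last by split => //; case: yv.
by apply: (above_factor KL (MS_place mv) (MS_place mw) yv.1) => //; case: yv.
Qed.

Lemma Ybasic_sub v w : place_above w v -> Ybasic w `<=` Ybasic v.
Proof. by move=> wv y [py yw]; split => //; exact: subset_trans wv. Qed.

Lemma Ybasic_unique K v v' y : is_place K v -> is_place K v' -> Ybasic v y -> Ybasic v' y ->
  v = v'.
Proof. by move=> pv pv' [py yv] [_ yv']; exact: (above_unique pv pv' py). Qed.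

Lemma openX_Ybasic K v : is_number_field K -> is_place K v -> openX S (Ybasic v `&` Xset S).
Proof.
move=> nfK pv; split; first exact: subIsetr.
by move=> x [xv Xx]; exists K, v; split => //; exact: subset_refl.
Qed.

(** * Compactness of the sets Y(K,v) *)

Definition finitely_covered (F : set (set (set (algC -> R)))) (C : set (set (algC -> R))) :=
  exists s : seq (set (set (algC -> R))),
    (forall U, U \in s -> F U) /\ C `<=` \bigcup_(U in [set U | U \in s]) U.

Lemma finitely_covered_bigcup F (r : seq (set (algC -> R))) C :
  (forall w, w \in r -> finitely_covered F (Ybasic w)) ->
  C `<=` \bigcup_(w in [set` r]) Ybasic w -> finitely_covered F C.
Proof.
move=> h sub.
have [s [sF ss]] : exists s : seq (set (set (algC -> R))), (forall U, U \in s -> F U) /\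
    forall w, w \in r -> Ybasic w `<=` \bigcup_(U in [set U | U \in s]) U.
  elim: r h {sub} => [|w r IH] h; first by exists [::].
  have [w' w'r|s [sF ss]] := IH; first by apply: h; rewrite inE w'r orbT.
  have [t [tF tt]] := h w (mem_head _ _).
  exists (t ++ s); split=> [U|w'].
    by rewrite mem_cat => /orP[/tF|/sF].
  rewrite inE => /predU1P[->|w'r] y.
    by move=> /tt[U Ut Uy]; exists U => //=; rewrite mem_cat Ut.
  by move=> /(ss _ w'r)[U Us Uy]; exists U => //=; rewrite mem_cat Us orbT.
by exists s; split => // y /sub[w wr]; exact: ss.
Qed.

(** The branching step of Koenig's lemma: Y(K,w) is a finite union of pieces over [L], and finite
    subcovers of all pieces would combine. *)
Lemma not_finitely_covered_above F K L w : subfield K -> is_number_field L -> K `<=` L ->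
  MS S K w -> ~ finitely_covered F (Ybasic w) ->
  exists w', [/\ is_place L w', place_above w' w & ~ finitely_covered F (Ybasic w')].
Proof.
move=> sK nfL KL mw nc; apply: contrapT => none; apply: nc.
have /finite_seqP[r rE] := finite_places_above nfL sK KL (MS_place mw).
apply: (@finitely_covered_bigcup F r).
  move=> w' w'r; have : [set` r] w' by [].
  by rewrite -rE => -[pw' ww']; apply: contrapT => nc; apply: none; exists w'.
move=> y yw; have [w' [mw' w'w yw']] := Ybasic_refine (number_field_subfield nfL) KL mw yw.
by exists w' => //; rewrite -rE; split => //; exact: MS_place mw'.
Qed.

Lemma absval_tower phi n0 : (forall n, is_absval (tower (n0 + n)) phi) -> is_absval setT phi.
Proof.
move=> h; have pair (x y : algC) : exists n, tower (n0 + n) x /\ tower (n0 + n) y.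
  have [n hn] := seq_tower [:: x; y]; exists n.
  by split; apply: (tower_mono (leq_addl n0 n)); apply: hn; rewrite !inE eqxx ?orbT.
split.
- by move=> x _; have [n [xn _]] := pair x x; exact: (absval_ge0 (h n)).
- by move=> x _; have [n [xn _]] := pair x x; exact: (absval_eq0 (h n)).
- by move=> x y _ _; have [n [xn yn]] := pair x y; exact: (absvalM (h n)).
- by move=> x y _ _; have [n [xn yn]] := pair x y; exact: (absvalD (h n)).
Qed.

(* If no finite subfamily covers, some place above v at each level of the tower
   inherits this; the limit of these places contradicts the openness of a
   member of the cover containing it. *)
Lemma compactX_Ybasic K v : is_number_field K -> MS S K v -> compactX S (Ybasic v).
Proof.
move=> nfK mv; have pv := MS_place mv; have sK := number_field_subfield nfK.
split; first by move=> y; exact: Ybasic_X mv.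
move=> F Fo cov; apply: contrapT => nc.
have [n0 Kn0] := number_field_sub_tower nfK.
pose T n := tower (n0 + n).
have KT n : K `<=` T n by apply: subset_trans Kn0 _; apply: tower_mono; exact: leq_addr.
have TT m n : (m <= n)%N -> T m `<=` T n by move=> mn; apply: tower_mono; rewrite leq_add2l.
have sT n : subfield (T n) by exact/number_field_subfield/tower_number_field.
pose P n psi := [/\ MS S (T n) (place_of (T n) psi), is_absval (T n) psi, v psi &
  ~ finitely_covered F (Ybasic (place_of (T n) psi))].
have placeP n w psi : is_place (T n) w -> place_above w v -> w psi ->
    ~ finitely_covered F (Ybasic w) -> P n psi.
  move=> pw wv wpsi ncw; have [av _ wE] := place_ofP pw wpsi.
  by split => //; rewrite -?wE //; [exact: (MS_above mv pw)|exact: wv].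
have [psi0 P0] : exists psi, P 0%N psi.
  have [w [pw wv ncw]] := not_finitely_covered_above sK (tower_number_field _) (KT 0%N) mv nc.
  by have [psi wpsi] := place_nonempty pw; exists psi; exact: placeP wpsi ncw.
(* The representative one level up extends the previous one exactly, not just up to a power, so that
   values stabilize along the tower. *)
have step n psi : P n psi -> exists psi', P n.+1 psi' /\ forall x, T n x -> psi' x = psi x.
  move=> [mw av vpsi ncw]; have TS : T n `<=` T n.+1 by exact: TT.
  have [w' [pw' ww' ncw']] :=
    not_finitely_covered_above (sT n) (tower_number_field _) TS mw ncw.
  have [psi' [wpsi' e]] := place_normalize (sT n) (sT n.+1) TS (MS_place mw) pw'
    (place_of_id av) ww'.
  exists psi'; split => //; apply: (placeP n.+1 w') => //.
  apply: subset_trans ww' _.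
  exact: (place_above_of (KT n) pv (MS_place mw) (place_of_id av) vpsi).
pose X := (nat * (algC -> R))%type.
(* Stated as an implication to make the relation total, as dependent choice requires. *)
pose Rel (a b : X) := P a.1 a.2 ->
  [/\ b.1 = a.1.+1, P b.1 b.2 & forall x, T a.1 x -> b.2 x = a.2 x].
have H (a : X) : {b | Rel a b}.
  apply: cid; have [Pa|nPa] := pselect (P a.1 a.2); last by exists a.
  by have [psi' [Pp e]] := step _ _ Pa; exists (a.1.+1, psi') => _; split.
have [f [f0 fS]] := dependent_choice H (0%N, psi0).
have fP n : (f n).1 = n /\ P n (f n).2.
  elim: n => [|n [e1 Pn]]; first by rewrite f0.
  have := fS n; rewrite /Rel e1 => /(_ Pn)[e2 Pn1 _].
  by split => //; move: Pn1; rewrite e2.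
pose psi n := (f n).2.
have psiS n x : T n x -> psi n.+1 x = psi n x.
  by have [e1 Pn] := fP n; have := fS n; rewrite /Rel e1 => /(_ Pn)[_ _ h]; exact: h.
have psi_le m n x : (m <= n)%N -> T m x -> psi n x = psi m x.
  move=> mn Tx; elim: n mn => [|n IH]; first by rewrite leqn0 => /eqP ->.
  rewrite leq_eqVlt => /predU1P[-> //|]; rewrite ltnS => mn.
  by rewrite psiS ?IH //; exact: (TT m).
pose lim x := psi (pickle x).+1 x.
have limE n x : T n x -> lim x = psi n x.
  move=> Tx; have Tx' : T (pickle x).+1 x.
    by apply: (tower_mono (leq_addl _ _)); exact: mem_tower.
  rewrite /lim -(@psi_le _ (maxn n (pickle x).+1) x _ Tx') ?leq_maxr //.
  by rewrite (@psi_le n) ?leq_maxl.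
have avT : is_absval setT lim.
  apply: (@absval_tower _ n0) => n; have [_ [_ av _ _]] := fP n.
  by apply: (absval_eq_on (limE n) _ av); case: (sT n).
have vlim : v lim.
  have [_ [_ _ vp _]] := fP 0%N; apply: (place_of_eq_on _ pv vp); first by case: sK.
  by move=> x Kx; apply: limE; exact: KT.
have [_ ntK _] := place_ofP pv vlim.
have py : is_place setT (place_of setT lim).
  by apply: is_place_place_of => //; exact: nontrivial_sub ntK.
have KsT : K `<=` setT by [].
have yv : Ybasic v (place_of setT lim).
  by split => //; exact: (place_above_of KsT pv py (place_of_id avT)).
have [U FU Uy] := cov _ yv; have [_ /(_ _ Uy)[M [u [nfM pu uy uU]]]] := Fo _ FU.
have [n1 Mn1] := number_field_sub_tower nfM.
have MT : M `<=` T n1 by apply: subset_trans Mn1 _; apply: tower_mono; exact: leq_addl.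
(* At a level containing [M], the single open set [U] already covers. *)
have [_ [mw av _ ncw]] := fP n1; apply: ncw.
exists [:: U]; split; first by move=> U'; rewrite inE => /eqP ->.
move=> y yw; exists U; first by rewrite /= mem_head.
apply: uU; split; last exact: (Ybasic_X mw).
apply: Ybasic_sub yw.
have wlim : place_of (T n1) (f n1).2 lim.
  apply: (place_of_eq_on _ (MS_place mw) (place_of_id av)); first by case: (sT n1).
  exact: limE.
apply: (place_above_of MT pu (MS_place mw) wlim).
by case: uy => _; apply; exact: place_of_id.
Qed.

(** * Functions in LC_c(X) as functions on the places of one number field *)

Implicit Types (f g : set (algC -> R) -> R) (c : set algC -> set (algC -> R) -> R).

Lemma fvalE v y f : (forall y z, Ybasic v y -> Ybasic v z -> f y = f z) ->
  Ybasic v y -> fval f v = f y.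
Proof.
move=> cst vy; rewrite /fval; case: xgetP => [r _ [z vz ->]|none]; first exact: cst.
by case: (none (f y)); exists y.
Qed.

Lemma compactX_bigcup (r : seq (set (algC -> R))) :
  (forall w, w \in r -> compactX S (Ybasic w)) ->
  compactX S (\bigcup_(w in [set` r]) Ybasic w).
Proof.
move=> h; split; first by move=> y [w /= wr wy]; exact: (h w wr).1.
move=> F Fo cov; apply: (finitely_covered_bigcup (r := r)) => // w wr.
apply: (h w wr).2 => // y wy; apply: cov; by exists w.
Qed.

Definition fsupp K f : set (set (algC -> R)) :=
  [set v | MS S K v /\ exists2 y, Ybasic v y & f y != 0].

(** The Y(K,v) are open and partition X, so the closure of the support is the union of those in
    [fsupp K f]: finitely many compact sets. *)
Lemma adapted_LCc K f : adapted S K f -> LCc S f.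
Proof.
move=> [nfK cst fin]; have sK := number_field_subfield nfK.
have restr x : Xset S x -> exists v, MS S K v /\ Ybasic v x.
  move=> Xx; have [v [mv xv]] := @MS_restrict K setT x sK (fun _ _ => I) Xx.
  by exists v; split => //; split => //; case: Xx.
split.
  move=> x Xx; have [v [mv vx]] := restr x Xx; exists (Ybasic v `&` Xset S); split => //.
    exact: openX_Ybasic nfK (MS_place mv).
  by move=> y [vy _]; exact: (cst v).
have /finite_seqP[r rE] := fin.
have -> : closureX S (supportX S f) = \bigcup_(w in [set` r]) Ybasic w.
  rewrite -rE; apply/seteqP; split=> x.
    move=> [Xx cl]; have [v [mv vx]] := restr x Xx.
    have [|z [[vz _] [_ fz]]] := cl _ (openX_Ybasic nfK (MS_place mv)); first by split.
    by exists v => //; split => //; exists z.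
  move=> [v [mv [y vy fy]] vx]; have Xx := Ybasic_X mv vx; split => // U oU Ux.
  by exists x; split => //; split => //; rewrite (cst v mv x y).
apply: compactX_bigcup => w wr; have : [set` r] w by [].
by rewrite -rE => -[mw _]; exact: compactX_Ybasic mw.
Qed.

(** Finitely many Y(K,v) on which [f] is constant cover the support. At a tower stage containing all
    these K, any place w with [f] nonzero somewhere on Y(w) lies above one of these v, which gives
    both constancy and finiteness. *)
Lemma LCc_adapted f : LCc S f -> exists n, adapted S (tower n) f.
Proof.
move=> [lc [_ comp]].
pose good K v := [/\ is_number_field K, is_place K v &
  forall y z, (Ybasic v `&` Xset S) y -> (Ybasic v `&` Xset S) z -> f y = f z].
pose F := [set U | exists K v, good K v /\ U = Ybasic v `&` Xset S].
have [||s [sF cov]] := comp F.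
- by move=> _ [K [v [[nfK pv _] ->]]]; exact: openX_Ybasic nfK pv.
- move=> x [Xx _]; have [U [oU Ux cU]] := lc x Xx.
  have [_ /(_ x Ux)[K [v [nfK pv vx sub]]]] := oU.
  exists (Ybasic v `&` Xset S) => //; exists K, v; split => //; split => //.
  by move=> y z /sub/cU -> /sub/cU ->.
have [n hn] : exists n, forall U, U \in s -> exists K v,
    [/\ K `<=` tower n, good K v & U = Ybasic v `&` Xset S].
  elim: s sF {cov} => [|U s IH] sF; first by exists 0%N.
  have [U' U's|n hn] := IH; first by apply: sF; rewrite inE U's orbT.
  have [K [v [gKv UE]]] := sF U (mem_head _ _).
  have [m Km] := number_field_sub_tower (let: And3 h _ _ := gKv in h).
  exists (maxn m n) => U'; rewrite inE => /predU1P[->|/hn[K' [v' [K'n gKv' U'E]]]].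
    by exists K, v; split => //; apply: subset_trans Km _; apply: tower_mono; exact: leq_maxl.
  by exists K', v'; split => //; apply: subset_trans K'n _; apply: tower_mono; exact: leq_maxr.
have nfT := tower_number_field n; have sT := number_field_subfield nfT.
have key w y : MS S (tower n) w -> Ybasic w y -> f y != 0 ->
    exists U, U \in s /\ forall K v, K `<=` tower n -> good K v -> U = Ybasic v `&` Xset S ->
      place_above w v.
  move=> mw wy fy; have Xy := Ybasic_X mw wy.
  have [|U Us Uy] := cov y.
    by split => // V oV Vy; exists y; split.
  exists U; split => // K v KT [nfK pv _] UE.
  move: Uy; rewrite UE => -[vy _].
  by apply: (above_factor KT pv (MS_place mw) wy.1); [case: vy|case: wy].
have cst w : MS S (tower n) w -> forall y z, Ybasic w y -> Ybasic w z -> f y != 0 -> f y = f z.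
  move=> mw y z wy wz fy; have [U [Us hU]] := key w y mw wy fy.
  have [K [v [KT gKv UE]]] := hn U Us; have wv := hU K v KT gKv UE.
  case: gKv => nfK pv; apply; split.
  - exact: Ybasic_sub wy.
  - exact: (Ybasic_X mw wy).
  - exact: Ybasic_sub wz.
  - exact: (Ybasic_X mw wz).
exists n; split => //.
  move=> w mw y z wy wz; have [fy|fy] := eqVneq (f y) 0; last exact: (cst w).
  by have [fz|fz] := eqVneq (f z) 0; [rewrite fy fz|rewrite (cst w mw z y)].
have /choice[h hh] : forall U, exists v, U \in s ->
    exists K, [/\ K `<=` tower n, good K v & U = Ybasic v `&` Xset S].
  move=> U; have [Us|Us] := boolP (U \in s); last by exists set0.
  by have [K [v hv]] := hn U Us; exists v => _; exists K.
apply: (@sub_finite_set _ _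
  (\bigcup_(U in [set` s]) [set w | is_place (tower n) w /\ place_above w (h U)])).
  move=> w [mw [y wy fy]]; have [U [Us hU]] := key w y mw wy fy.
  exists U => //; split; first exact: MS_place mw.
  by have [K [KT gKv UE]] := hh U Us; exact: hU gKv UE.
apply: bigcup_finite; first by apply/finite_seqP; exists s.
move=> U /= Us; have [K [KT [nfK pv _] _]] := hh U Us.
exact: (finite_places_above nfT (number_field_subfield nfK) KT pv).
Qed.

Lemma adapted_mono K M f : is_number_field M -> K `<=` M -> adapted S K f -> adapted S M f.
Proof.
move=> nfM KM [nfK cst fin]; have sK := number_field_subfield nfK; split => //.
  move=> w mw y z wy wz; have [v [mv wv]] := MS_restrict sK KM mw.
  by apply: (cst v mv); exact: (Ybasic_sub wv).
apply: (@sub_finite_set _ _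
    (\bigcup_(v in fsupp K f) [set w | is_place M w /\ place_above w v])).
  move=> w [mw [y wy fy]]; have [v [mv wv]] := MS_restrict sK KM mw.
  exists v; last by split => //; exact: MS_place mw.
  by split => //; exists y => //; exact: (Ybasic_sub wv).
apply: bigcup_finite => // v [mv _]; exact: (finite_places_above nfM sK KM (MS_place mv)).
Qed.

Lemma fval_eq0 K f v : adapted S K f -> MS S K v -> ~ fsupp K f v -> fval f v = 0.
Proof.
move=> [nfK cst _] mv nv.
have [y vy] := Ybasic_nonempty (number_field_subfield nfK) mv.
rewrite (fvalE (cst v mv) vy); apply/eqP/negPn/negP => fy; apply: nv.
by split => //; exists y.
Qed.

(** * The functional attached to a consistent map *)

Lemma Phi_at_sum c K f (B : set (set (algC -> R))) : adapted S K f ->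
  fsupp K f `<=` B -> B `<=` MS S K -> Phi_at S c K f = \sum_(v \in B) c K v * fval f v.
Proof.
move=> af fB BK; apply: esym; apply: fsbig_widen => // v [mv nB] /=.
by rewrite (fval_eq0 af mv) ?mulr0 // => /fB.
Qed.

(** Expand each c(K,v) by consistency and exchange the two sums; a place of [M] lies above exactly
    one place of [K]. *)
Lemma Phi_at_mono c K M f : consistent S c -> adapted S K f -> is_number_field M ->
  K `<=` M -> Phi_at S c K f = Phi_at S c M f.
Proof.
move=> cc af nfM KM; have [nfK cst fin] := af; have sK := number_field_subfield nfK.
have afM := adapted_mono nfM KM af; have [_ cstM _] := afM.
pose A v := [set w | is_place M w /\ place_above w v].
pose BM := \bigcup_(v in fsupp K f) A v.
have finA v : MS S K v -> finite_set (A v).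
  by move=> mv; exact: (finite_places_above nfM sK KM (MS_place mv)).
have finB : finite_set BM by apply: bigcup_finite => // v [mv _]; exact: finA.
have BMM : BM `<=` MS S M by move=> w [v [mv _] [pw wv]]; exact: (MS_above mv).
have fBM : fsupp M f `<=` BM.
  move=> w [mw [y wy fy]]; have [v [mv wv]] := MS_restrict sK KM mw.
  exists v; last by split => //; exact: MS_place mw.
  by split => //; exists y => //; exact: (Ybasic_sub wv).
rewrite (Phi_at_sum c afM fBM BMM) (@Phi_at_sum c K f (fsupp K f)) //; last by move=> v [].
(* Extension by zero puts the double sum on a product index set, where it can be exchanged. *)
pose G v w := if `[< place_above w v >] then c M w * fval f w else 0.
transitivity (\sum_(v \in fsupp K f) \sum_(w \in BM) G v w).
  apply: eq_fsbigr => v; rewrite inE => -[mv sv].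
  rewrite (cc K v M) // -(@fsbig_widen _ _ _ _ (A v) BM); first last.
  - move=> w [[v' [mv' _] [pw wv']] nA] /=; rewrite /G; case: asboolP => // wv.
    by case: nA.
  - by move=> w Aw; exists v.
  rewrite mulrC mulr_fsumr; apply: eq_fsbigr => w; rewrite inE => -[pw wv].
  have mw := MS_above mv pw wv.
  have [y wy] := Ybasic_nonempty (number_field_subfield nfM) mw.
  rewrite /G asboolT // mulrC (fvalE (cstM w mw) wy).
  by rewrite (fvalE (cst v mv) (Ybasic_sub wv wy)).
rewrite exchange_fsbig //; apply: eq_fsbigr => w; rewrite inE => -[v sv [pw wv]].
rewrite -(@fsbig_widen _ _ _ _ [set v]) ?fsbig_set1; first by rewrite /G asboolT.
- by move=> _ ->.
- move=> v' [sv' nv'] /=; rewrite /G; case: asboolP => // wv'; case: nv'.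
  by case: sv sv' => mv _ [mv' _]; exact: (above_unique (MS_place mv') (MS_place mv) pw).
Qed.

(** The field chosen in [Phi] and the given [K] are compared inside a common tower stage. *)
Lemma PhiE c K f : consistent S c -> adapted S K f -> Phi S c f = Phi_at S c K f.
Proof.
move=> cc af; rewrite /Phi; case: xgetP => [r _ [K' af' ->]|none]; last first.
  by case: (none (Phi_at S c K f)); exists K.
have [nfK _ _] := af; have [nfK' _ _] := af'.
have [n Kn] := number_field_sub_tower nfK; have [n' Kn'] := number_field_sub_tower nfK'.
have nfT := tower_number_field (maxn n n').
have KT : K `<=` tower (maxn n n').
  by apply: subset_trans Kn _; apply: tower_mono; exact: leq_maxl.
have KT' : K' `<=` tower (maxn n n').
  by apply: subset_trans Kn' _; apply: tower_mono; exact: leq_maxr.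
by rewrite (Phi_at_mono cc af nfT KT) (Phi_at_mono cc af' nfT KT').
Qed.

Lemma LCc_adapted2 f g : LCc S f -> LCc S g -> exists K, adapted S K f /\ adapted S K g.
Proof.
move=> /LCc_adapted[m am] /LCc_adapted[n an]; exists (tower (maxn m n)).
have nfT := tower_number_field (maxn m n).
split; [apply: adapted_mono am|apply: adapted_mono an] => //; apply: tower_mono.
  exact: leq_maxl.
exact: leq_maxr.
Qed.

Lemma adapted_lin K f g (a b : R) : adapted S K f -> adapted S K g ->
  adapted S K (fun x => a * f x + b * g x).
Proof.
move=> [nfK cf ff] [_ cg fg]; split => //.
  by move=> v mv y z vy vz; rewrite (cf v mv y z) // (cg v mv y z).
apply: (@sub_finite_set _ _ (fsupp K f `|` fsupp K g)); last by rewrite finite_setU.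
move=> v [mv [y vy h]]; have [fy|fy] := eqVneq (f y) 0; last by left; split => //; exists y.
right; split => //; exists y => //; apply: contra_neq h => ->.
by rewrite fy !mulr0 addr0.
Qed.

Lemma fval_lin K f g (a b : R) v : adapted S K f -> adapted S K g -> MS S K v ->
  fval (fun x => a * f x + b * g x) v = a * fval f v + b * fval g v.
Proof.
move=> af ag mv; have [_ ch _] := adapted_lin a b af ag.
have [nfK cf _] := af; have [_ cg _] := ag.
have [y vy] := Ybasic_nonempty (number_field_subfield nfK) mv.
by rewrite (fvalE (ch v mv) vy) (fvalE (cf v mv) vy) (fvalE (cg v mv) vy).
Qed.

Lemma Phi_linear c f g (a b : R) : consistent S c -> LCc S f -> LCc S g ->
  Phi S c (fun x => a * f x + b * g x) = a * Phi S c f + b * Phi S c g.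
Proof.
move=> cc lf lg; have [K [af ag]] := LCc_adapted2 lf lg.
have ah := adapted_lin a b af ag.
rewrite (PhiE cc ah) (PhiE cc af) (PhiE cc ag).
have [_ _ ff] := af; have [_ _ fg] := ag; have [_ _ fh] := ah.
pose B := fsupp K f `|` fsupp K g `|` fsupp K (fun x => a * f x + b * g x).
have finB : finite_set B by rewrite !finite_setU.
have BK : B `<=` MS S K by move=> v [[|]|] [].
rewrite (@Phi_at_sum c K f B) //; last by move=> v ?; left; left.
rewrite (@Phi_at_sum c K g B) //; last by move=> v ?; left; right.
rewrite (@Phi_at_sum c K _ B ah) //; last by move=> v ?; right.
rewrite !mulr_fsumr -fsbig_split //=; apply: eq_fsbigr => v; rewrite inE => /BK mv.
by rewrite (fval_lin a b af ag mv); ring.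
Qed.

Lemma Phi_ext c f g : consistent S c -> LCc S f -> LCc S g ->
  (forall x, Xset S x -> f x = g x) -> Phi S c f = Phi S c g.
Proof.
move=> cc lf lg e; have [K [af ag]] := LCc_adapted2 lf lg.
rewrite (PhiE cc af) (PhiE cc ag); apply: eq_fsbigr => v; rewrite inE => mv.
have [nfK cf _] := af; have [_ cg _] := ag.
have [y vy] := Ybasic_nonempty (number_field_subfield nfK) mv.
by rewrite (fvalE (cf v mv) vy) (fvalE (cg v mv) vy) e //; exact: (Ybasic_X mv vy).
Qed.

Lemma consistent_lin c1 c2 (a b : R) : consistent S c1 -> consistent S c2 ->
  consistent S (fun K v => a * c1 K v + b * c2 K v).
Proof.
move=> h1 h2 K v L [nfK mv] nfL KL; rewrite (h1 K v L) // (h2 K v L) //.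
rewrite fsbig_split /= -?mulr_fsumr //.
exact: (finite_places_above nfL (number_field_subfield nfK) KL (MS_place mv)).
Qed.

(** * Indicators of the sets Y(K,v) *)

Definition indic v y : R := (`[< Ybasic v y >])%:R.

(** Disjointness of the Y(K,w) leaves only the term at [v]. The alternative [a v = 0] serves sums
    restricted to the support of a function. *)
Lemma sum_indic K (A : set (set (algC -> R))) (a : set (algC -> R) -> R) v y :
  A `<=` MS S K -> MS S K v -> Ybasic v y -> A v \/ a v = 0 ->
  \sum_(w \in A) a w * indic w y = a v.
Proof.
move=> AK mv vy Av.
have zero w : MS S K w -> w <> v -> a w * indic w y = 0.
  move=> mw nwv; rewrite /indic; case: asboolP => [wy|_]; last by rewrite mulr0.
  by case: nwv; exact: (Ybasic_unique (MS_place mw) (MS_place mv) wy).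
have [Av'|nAv] := pselect (A v).
  rewrite -(@fsbig_widen _ _ _ _ [set v]) ?fsbig_set1.
  - by rewrite /indic asboolT // mulr1.
  - by move=> _ ->.
  - by move=> w [Aw nwv] /=; apply: zero => //; exact: AK.
case: Av => // ->; rewrite fsbig1 // => w Aw; apply: zero; first exact: AK.
by move=> wv; rewrite wv in Aw.
Qed.

Lemma adapted_indic K v : is_number_field K -> MS S K v -> adapted S K (indic v).
Proof.
move=> nfK mv; have pv := MS_place mv; split => //.
  move=> w mw y z wy wz; have pw := MS_place mw; rewrite /indic.
  have same y' z' : Ybasic w y' -> Ybasic w z' -> Ybasic v y' -> Ybasic v z'.
    by move=> wy' wz' vy'; rewrite -(Ybasic_unique pw pv wy' vy').
  by congr (nat_of_bool _)%:R; apply/asbool_equiv_eq; split; exact: same.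
apply: (@sub_finite_set _ _ [set v]); last exact: finite_set1.
move=> w [mw [z wz]]; rewrite /indic; case: asboolP => [vz _|_]; last by rewrite eqxx.
exact: (Ybasic_unique (MS_place mw) pv wz).
Qed.

Lemma adapted0 K : is_number_field K -> adapted S K (fun=> 0).
Proof.
move=> nfK; split => //; rewrite [X in finite_set X](_ : _ = set0) //.
by apply/seteqP; split=> // v [_ [y _]]; rewrite eqxx.
Qed.

Lemma Phi_indic c K v : consistent S c -> is_number_field K -> MS S K v ->
  Phi S c (indic v) = c K v.
Proof.
move=> cc nfK mv; have ai := adapted_indic nfK mv; rewrite (PhiE cc ai).
have [y vy] := Ybasic_nonempty (number_field_subfield nfK) mv.
rewrite (@Phi_at_sum c K _ [set v] ai) ?fsbig_set1.
- by have [_ cst _] := ai; rewrite (fvalE (cst v mv) vy) /indic asboolT // mulr1.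
- move=> w [mw [z wz]]; rewrite /indic; case: asboolP => [vz _|_]; last by rewrite eqxx.
  exact: (Ybasic_unique (MS_place mw) (MS_place mv) wz).
- by move=> _ ->.
Qed.

(** Linearity is given for binary combinations of functions in LC_c(X), so the induction carries
    adaptedness along with the value. *)
Lemma dual_sum lam K (A : set (set (algC -> R))) (a : set (algC -> R) -> R) :
  dual_functional S lam -> is_number_field K -> A `<=` MS S K -> finite_set A ->
  adapted S K (fun y => \sum_(v \in A) a v * indic v y) /\
  lam (fun y => \sum_(v \in A) a v * indic v y) = \sum_(v \in A) a v * lam (indic v).
Proof.
move=> [_ lin] nfK AK finA.
have eA (F : set (algC -> R) -> R) := @fsbig_finite _ _ +%R _ A F finA.
rewrite (_ : (fun y => _) =
    fun y => \sum_(v <- finmap.enum_fset (fset_set A)) a v * indic v y); last first.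
  by apply/funext => y; rewrite eA.
rewrite eA; have : forall v, v \in finmap.enum_fset (fset_set A) -> MS S K v.
  by move=> v; rewrite in_fset_set // inE; exact: AK.
elim: (finmap.enum_fset _) => [|v r IH] h.
  rewrite (_ : (fun y => _) = fun=> 0); last by apply/funext => y; rewrite big_nil.
  have a0 := adapted0 nfK; split => //; rewrite big_nil.
  have := lin _ _ 0 0 (adapted_LCc a0) (adapted_LCc a0); rewrite !mul0r addr0 => lam0.
  by rewrite -[RHS]lam0; congr lam; apply/funext => y; rewrite mulr0 addr0.
have [w wr|ar lr] := IH; first by apply: h; rewrite inE wr orbT.
have ai := adapted_indic nfK (h v (mem_head _ _)).
rewrite (_ : (fun y => _) =
    fun y => a v * indic v y + 1 * \sum_(w <- r) a w * indic w y); last first.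
  by apply/funext => y; rewrite big_cons mul1r.
split; first exact: adapted_lin.
by rewrite (lin _ _ _ _ (adapted_LCc ai) (adapted_LCc ar)) big_cons lr mul1r.
Qed.

End PlacesOfS.

(** * The isomorphism onto the algebraic dual *)

Theorem theorem1p2 (R : realType) (S : set (set (algC -> R))) :
  (forall s, S s -> is_place Qfield s) ->
  (* Phi_c lies in the algebraic dual L^* *)
  (forall c, consistent S c -> dual_functional S (Phi S c)) /\
  (* Phi^* is linear *)
  (forall c1 c2 (a b : R), consistent S c1 -> consistent S c2 ->
     forall f, LCc S f ->
       Phi S (fun K v => a * c1 K v + b * c2 K v) f
       = a * Phi S c1 f + b * Phi S c2 f) /\
  (* Phi^* is injective (consistent maps are compared on J) *)
  (forall c1 c2, consistent S c1 -> consistent S c2 ->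
     (forall f, LCc S f -> Phi S c1 f = Phi S c2 f) ->
     forall K v, inJ S K v -> c1 K v = c2 K v) /\
  (* Phi^* is surjective onto L^* *)
  (forall lam, dual_functional S lam ->
     exists c, consistent S c /\ forall f, LCc S f -> Phi S c f = lam f).
Proof.
move=> placeS; split; [|split; [|split]].
- move=> c cc; split=> [f g|f g a b] lf lg; first exact: Phi_ext.
  exact: Phi_linear.
- move=> c1 c2 a b h1 h2 f lf; have [n af] := LCc_adapted lf.
  have h := consistent_lin a b h1 h2.
  rewrite (PhiE placeS h af) (PhiE placeS h1 af) (PhiE placeS h2 af).
  have fK : fsupp S (tower n) f `<=` MS S (tower n) by move=> v [].
  have [_ _ fin] := af.
  rewrite !(Phi_at_sum _ af (fun _ h => h) fK) !mulr_fsumr -fsbig_split //=.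
  by apply: eq_fsbigr => v _; ring.
- move=> c1 c2 h1 h2 e K v [nfK mv].
  rewrite -(Phi_indic placeS h1 nfK mv) -(Phi_indic placeS h2 nfK mv); apply: e.
  exact: (adapted_LCc placeS (adapted_indic nfK mv)).
- move=> lam dl; pose c (K : set algC) v := lam (indic v).
  (* On X, the indicator of Y(K,v) is the sum of those of Y(L,w) over w dividing v; applying [lam]
     gives consistency. *)
  have cc : consistent S c.
    move=> K v L [nfK mv] nfL KL; have sK := number_field_subfield nfK.
    have pv := MS_place mv; set A := [set w | _].
    have finA : finite_set A by exact: (finite_places_above nfL sK KL pv).
    have AL : A `<=` MS S L by move=> w [pw wv]; exact: (MS_above mv).
    have [aA lA] := dual_sum placeS (fun=> 1) dl nfL AL finA.
    transitivity (\sum_(w \in A) 1 * lam (indic w)); last first.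
      by apply: eq_fsbigr => w _; rewrite mul1r.
    rewrite -lA; apply: dl.1.
    + exact: (adapted_LCc placeS (adapted_indic nfK mv)).
    + exact: adapted_LCc aA.
    move=> x Xx.
    have [w [mw xw]] := MS_restrict placeS (number_field_subfield nfL) (fun _ _ => I) Xx.
    have wx : Ybasic w x by split => //; case: Xx.
    rewrite {1}/indic; case: asboolP => [vx|nvx].
      rewrite (sum_indic AL mw wx) //; left; split; first exact: MS_place mw.
      by apply: (above_factor KL pv (MS_place mw) wx.1) => //; case: vx.
    rewrite fsbig1 // => w' [pw' w'v]; rewrite /indic.
    case: asboolP => [w'x|_]; last by rewrite mulr0.
    by case: nvx; exact: (Ybasic_sub w'v).
  exists c; split => // f lf; have [n af] := LCc_adapted lf.
  have nfT := tower_number_field n; rewrite (PhiE placeS cc af).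
  have fK : fsupp S (tower n) f `<=` MS S (tower n) by move=> v [].
  have [_ cst fin] := af.
  rewrite (Phi_at_sum _ af (fun _ h => h) fK).
  (* On X, [f] is the combination of indicators with coefficients f(v), so [lam f] is the sum
     defining [Phi]. *)
  have [aA lA] := dual_sum placeS (fval f) dl nfT fK fin.
  transitivity (\sum_(v \in fsupp S (tower n) f) fval f v * lam (indic v)).
    by apply: eq_fsbigr => v _; rewrite mulrC.
  rewrite -lA; apply: dl.1 => //; first exact: adapted_LCc aA.
  move=> x Xx; have [v [mv xv]] := MS_restrict placeS (number_field_subfield nfT) (fun _ _ => I) Xx.
  have vx : Ybasic v x by split => //; case: Xx.
  rewrite (sum_indic fK mv vx) ?(fvalE (cst v mv) vx) //.
  have [fx|fx] := eqVneq (f x) 0; first by right.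
  by left; split => //; exists x.
Qed.
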